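(* For $\lambda\in(0,1)$ and $r\in[-1,1]\setminus\{0\}$, let $f_{r,\lambda}(x)=[1-\lambda+\lambda x^r]^{1/r}$. Assume that $T=U|T|\in\mathcal{B}(H)$ is invertible and centered. If $T\in\mathcal{K}(H)$ or $T$ is an $n\times n$ matrix, then $\lim_{n\to\infty}\Delta_{f_{r,\lambda}}^n(T)$ exists. Moreover, the limit point does not depend on $\lambda$.
   Context: $H$ is a complex Hilbert space, $\mathcal{B}(H)$ the bounded operators, $\mathcal{K}(H)$ the compact operators on $H$, $|T|=(T^*T)^{1/2}$; limits of operators are in the strong operator topology. If $T$ is invertible, $U$ in the polar decomposition $T=U|T|$ is unitary. The functions $f=f_{r,\lambda}$ are representing functions of operator means (power means): operator monotone on $(0,\infty)$ with $f(1)=1$. Induced Aluthge transformation: for invertible $T=U|T|$ with spectral decomposition $|T|=\int_{\sigma(|T|)}s\,dE_s$, define $\Delta_f(T):=\int_{\sigma(|T|)}\int_{\sigma(|T|)} s f(t/s)\,dE_s\,U\,dE_t$ (double operator integral). Concretely (known fact), if $\mu$ is a probability measure on $[0,1]$ with $f(x)=\int_0^1[1-\theta+\theta x^{-1}]^{-1}d\mu(\theta)$ for $x>0$ (such $\mu$ exists), then $\Delta_f(T)=\int_0^1\int_0^\infty e^{-(1-\theta)s|T|^{-1}}\,U\,e^{-\theta s|T|^{-1}}\,ds\,d\mu(\theta)$. Iterates: $\Delta_f^0(T)=T$, $\Delta_f^n(T)=\Delta_f(\Delta_f^{n-1}(T))$. $T=U|T|$ is centered if $\{U^{*m}|T|U^m,\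 |T|,\ U^n|T|U^{*n}: n,m=1,2,\dots\}$ is a commuting set. *)

(* Defs.v *)
From HB Require Import structures.
From mathcomp Require Import all_boot all_order all_algebra.
From mathcomp Require Import complex.
From mathcomp Require Import all_classical all_reals all_analysis.
Import Order.TTheory GRing.Theory Num.Theory.
Import numFieldNormedType.Exports.

Set Implicit Arguments.
Unset Strict Implicit.
Unset Printing Implicit Defensive.

Local Open Scope classical_set_scope.
Local Open Scope ring_scope.

(* A complex Hilbert space is a complete normed space [H] over [R[i]] together
   with an inner product [dot] (linear in its first argument, conjugate-linear
   in the second one) satisfying [hilbert_dot dot].  Norms are valued in [R[i]],
   where [0 < e] means that [e] is a positive real number. *)

Section HilbertSpace.
Variables (R : realType) (H : completeNormedModType R[i]).
Variable dot : {dot H for Num.conj}.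

Definition hilbert_dot : Prop := forall x : H, `|x| ^+ 2 = dot x x.

(* [H] is, up to a unitary identification of the two, the space C^n with its
   standard inner product, so that operators on [H] are n x n matrices. *)
Definition is_Cn (n : nat) : Prop :=
  exists J : {linear H -> 'cV[R[i]]_n},
    bijective J /\
    forall x y, dot x y = \sum_(i < n) J x i ord0 * Num.conj (J y i ord0).

Definition bounded_op (T : H -> H) : Prop := linear T /\ continuous T.

Definition invertible_op (T : H -> H) : Prop :=
  exists S, [/\ bounded_op S, S \o T = id & T \o S = id].

Definition compact_op (T : H -> H) : Prop :=
  compact (closure (T @` [set x | `|x| <= 1])).

Definition adj (T : H -> H) : H -> H :=
  get [set S | bounded_op S /\ forall x y, dot (T x) y = dot x (S y)].

Definition positive_op (A : H -> H) : Prop :=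
  bounded_op A /\ forall x, 0 <= dot (A x) x.

Definition abs_op (T : H -> H) : H -> H :=
  get [set A | positive_op A /\ A \o A = adj T \o T].

(* The partial isometry [U], with the same kernel as [T], of the polar
   decomposition [T = U |T|]. *)
Definition phase (T : H -> H) : H -> H :=
  get [set U | [/\ bounded_op U, U \o adj U \o U = U,
                   forall x, U x = 0 <-> T x = 0 & T = U \o abs_op T]].

Definition centered_family (T : H -> H) : set (H -> H) :=
  let U := phase T in
  [set iter m (adj U) \o abs_op T \o iter m U | m in [set m | (0 < m)%N]]
  `|` [set abs_op T]
  `|` [set iter n U \o abs_op T \o iter n (adj U) | n in [set n | (0 < n)%N]].

Definition centered (T : H -> H) : Prop :=
  forall X Y, centered_family T X -> centered_family T Y -> X \o Y = Y \o X.

Definition sot_cvg (D : nat -> H -> H) (L : H -> H) : Prop :=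
  forall x, D n x @[n --> \oo] --> L x.

(* The partition a < s_0 < ... < s_(k-1) = b has mesh < d, and t_i is a tag in
   the interval of right endpoint s_i. *)
Definition tagged_partition (a b d : R) (s t : seq R) : Prop :=
  [/\ itv_partition a b s, size t = size s &
      forall i, (i < size s)%N ->
        (a :: s)`_i <= t`_i <= s`_i /\ s`_i - (a :: s)`_i < d].

Definition increment (E : R -> H -> H) (a : R) (s : seq R) (i : nat) : H -> H :=
  fun x => E s`_i x - E (a :: s)`_i x.

(* [A] is the integral of [phi s] against [dE_s] over [a, b], as the limit in
   operator norm of Riemann-Stieltjes sums. *)
Definition spectral_integral (a b : R) (E : R -> H -> H) (phi : R -> R)
    (A : H -> H) : Prop :=
  forall e : R[i], 0 < e -> exists2 d : R, 0 < d &
    forall s t, tagged_partition a b d s t ->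
    forall x, `|\sum_(i < size s) (phi t`_i)%:C%C *: increment E a s i x - A x|
              <= e * `|x|.

(* [S] is the double operator integral of [phi s t] against [dE_s X dE_t] over
   [a, b] x [a, b], as the limit in operator norm of Riemann-Stieltjes sums.
   For phi s t = \int alpha(s, w) beta(t, w) dnu(w), with alpha and beta
   continuous in their first variable and \int |alpha| |beta| dnu finite for
   the sup norms, the sums converge to \int alpha(A, w) X beta(A, w) dnu(w)
   where A = \int s dE_s. *)
Definition double_operator_integral (a b : R) (E : R -> H -> H)
    (phi : R -> R -> R) (X S : H -> H) : Prop :=
  forall e : R[i], 0 < e -> exists2 d : R, 0 < d &
    forall s t s' t',
      tagged_partition a b d s t -> tagged_partition a b d s' t' ->
    forall x, `|\sum_(i < size s) \sum_(j < size s') (phi t`_i t'`_j)%:C%C *: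
                  increment E a s i (X (increment E a s' j x)) - S x|
              <= e * `|x|.

Definition orthogonal_projection (P : H -> H) : Prop :=
  [/\ bounded_op P, P \o P = P & adj P = P].

(* Resolution of the identity of the self-adjoint operator [A], whose spectrum
   is contained in ]a, b]. *)
Record spectral_resolution (A : H -> H) (a b : R) (E : R -> H -> H) : Prop := {
  resolution_lt : a < b ;
  resolution_proj : forall s, orthogonal_projection (E s) ;
  resolution_mono : forall s t, s <= t -> E s \o E t = E s ;
  resolution_right_cont : forall s x, E t x @[t --> s^'+] --> E s x ;
  resolution_left : E a = fun=> 0 ;
  resolution_right : E b = id ;
  resolution_integral : spectral_integral a b E id A }.

Definition is_aluthge (f : R -> R) (T S : H -> H) : Prop :=
  bounded_op S /\
  exists a b E, [/\ 0 < a, spectral_resolution (abs_op T) a b E &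
    double_operator_integral a b E (fun s t => s * f (t / s)) (phase T) S].

Definition aluthge (f : R -> R) (T : H -> H) : H -> H := get (is_aluthge f T).

End HilbertSpace.

Definition power_mean (R : realType) (r lambda x : R) : R :=
  (1 - lambda + lambda * x `^ r) `^ r^-1.

(* Main.v *)
Require Import Defs.
From HB Require Import structures.
From mathcomp Require Import all_boot all_order all_algebra all_fingroup.
From mathcomp Require Import complex.
From mathcomp Require Import all_classical all_reals all_analysis.
From mathcomp Require Import ring lra.
Import Order.TTheory GRing.Theory Num.Theory.
Import numFieldNormedType.Exports.

Set Implicit Arguments.
Unset Strict Implicit.
Unset Printing Implicit Defensive.

Local Open Scope classical_set_scope.
Local Open Scope ring_scope.

(** Both alternatives on [T] make [H] finite-dimensional, and the theorem becomes
    a statement about a random walk on the cycles of a permutation.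

    Write [T = U |T|] with [U] unitary.  As [T] is centered, the positive
    operators [U^*k |T| U^k] commute and share an orthonormal eigenbasis [e]; let
    [a_k j] be the eigenvalue of the [k]-th one at [e j], and [u i j] the matrix
    entries of [U].  The intertwining of the [k]-th operator with the next one by
    [U] says that [a_k i = a_(k+1) j] whenever [u i j != 0].  A unitary matrix has
    nonzero determinant, so the Leibniz formula provides a permutation [s] with
    [u (s j) j != 0] for all [j]; hence [a_k = a_0 \o s^k], and everything is
    encoded in the function [a = a_0] (the relation [linked]).

    In the basis [e] the Riemann-Stieltjes sums that define the Aluthge
    transform of [U diag(a)] have entries close to [phi (a i) (a j) * u i j], where
    [phi p q = p * f (q / p)] ([aluthge_diag]).  The nonzero entries have
    [a i = a (s j)], so the transform is
    [U diag(j |-> phi (a (s j)) (a j))], again of the same form and still linked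
    ([iter_aluthge]).  For the power mean,
    [(phi p q) ^ r = (1 - lambda) p ^ r + lambda q ^ r]: in the unknown
    [x = a ^ r] an iteration is the averaging [lambda x + (1 - lambda) (x \o s)].
    Its iterates converge to the average of [x] over the cycles of [s]
    ([lazy_walk_cvg]), and that average does not involve [lambda].

    The operations [adj], [abs_op], [phase] and [aluthge] being choices among all
    solutions of a specification, each computation below comes with a uniqueness
    argument; for [aluthge] it is the fact that a resolution of the identity of
    a diagonal operator is determined by that operator ([resolution_eigen]). *)

(** * Averaging along the cycles of a permutation *)

Section LazyWalk.
Variables (R : realType) (n : nat) (s : {perm 'I_n}) (lam : R).
Implicit Types x : 'I_n -> R.

(** The Markov operator of the walk that stays put with probability [lam] and
    otherwise moves along [s]. *)
Definition lazy_step x : 'I_n -> R := fun j => lam * x j + (1 - lam) * x (s j).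

Definition cycle_mean x : 'I_n -> R :=
  fun j => (#[s]%g)%:R^-1 * \sum_(k < #[s]%g) x ((s ^+ k)%g j).

Lemma lazy_step_mean x : cycle_mean (lazy_step x) = cycle_mean x.
Proof.
apply/funext => j; congr (_ * _).
rewrite /lazy_step big_split /= -!mulr_sumr.
have -> : \sum_(k < #[s]%g) x (s ((s ^+ k)%g j)) = \sum_(k < #[s]%g) x ((s ^+ k)%g j).
  have e k : s ((s ^+ k)%g j) = (s ^+ k.+1)%g j by rewrite expgSr permM.
  under eq_bigr do rewrite e.
  case: #[s]%g (expg_order s) => [|N] sN; first by rewrite !big_ord0.
  by rewrite big_ord_recr big_ord_recl /= sN expg0 addrC.
by rewrite -mulrDl subrKC mul1r.
Qed.

(** Pointwise this is the identity
    [(l p + (1 - l) q)^2 = l p^2 + (1 - l) q^2 - l (1 - l) (p - q)^2]; the first two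
    terms have the same sum because [s] is a permutation. *)
Lemma lazy_step_energy x :
  \sum_j lazy_step x j ^+ 2 =
  \sum_j x j ^+ 2 - lam * (1 - lam) * \sum_j (x j - x (s j)) ^+ 2.
Proof.
have es : \sum_j x (s j) ^+ 2 = \sum_j x j ^+ 2.
  by rewrite [RHS](reindex_inj (@perm_inj _ s)).
have -> : \sum_j x j ^+ 2 = lam * \sum_j x j ^+ 2 + (1 - lam) * \sum_j x (s j) ^+ 2.
  by rewrite es; ring.
rewrite !mulr_sumr -big_split -sumrB /=; apply: eq_bigr => j _.
by rewrite /lazy_step; ring.
Qed.

Hypothesis lam01 : 0 < lam < 1.

(** The energy decreases and is nonnegative, so its decrements tend to [0]: the
    iterates become constant along the cycles of [s], while their means over the
    cycles never change. *)
Lemma lazy_walk_cvg x j :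
  iter m lazy_step x j @[m --> \oo] --> cycle_mean x j.
Proof.
have [lam_gt0 lam_lt1] := andP lam01.
have c_gt0 : 0 < lam * (1 - lam) by rewrite mulr_gt0 ?subr_gt0.
pose X m := iter m lazy_step x.
pose E m := \sum_i X m i ^+ 2.
pose D m := \sum_i (X m i - X m (s i)) ^+ 2.
have ES m : E m.+1 = E m - lam * (1 - lam) * D m by exact: lazy_step_energy.
have D_ge0 m : 0 <= D m by apply: sumr_ge0 => i _; exact: sqr_ge0.
have E_cvg : cvgn E.
  apply: nonincreasing_is_cvgn.
    apply/nonincreasing_seqP => m; rewrite ES gerBl.
    by rewrite mulr_ge0 // ltW.
  by exists 0 => _ [m _ <-]; apply: sumr_ge0 => i _; exact: sqr_ge0.
have D_cvg : D m @[m --> \oo] --> (0 : R).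
  have -> : D = (fun m => (lam * (1 - lam))^-1 * (E m - E m.+1)).
    apply/funext => m; rewrite ES opprD opprK addNKr mulKf //.
    by rewrite gt_eqF.
  rewrite -(mulr0 (lam * (1 - lam))^-1); apply: cvgMr.
  rewrite -(subrr (limn E)); apply: cvgB => //.
  by rewrite (cvg_shiftS E).
have step i : X m i - X m (s i) @[m --> \oo] --> (0 : R).
  apply/cvgrPdist_lt => e e_gt0.
  have e2_gt0 : 0 < e ^+ 2 by rewrite exprn_gt0.
  have /cvgrPdist_lt/(_ _ e2_gt0) := D_cvg.
  apply: filterS => m; rewrite !sub0r !normrN ger0_norm // => De.
  rewrite -(@ltr_pXn2r _ 2) ?nnegrE ?(ltW e_gt0) //.
  rewrite real_normK ?num_real //.
  apply: le_lt_trans De; rewrite /D (bigD1 i) //= lerDl.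
  by apply: sumr_ge0 => k _; exact: sqr_ge0.
have steps k : X m j - X m ((s ^+ k)%g j) @[m --> \oo] --> (0 : R).
  elim: k => [|k IHk]; first by under eq_fun do rewrite expg0 perm1 subrr; exact: cvg_cst.
  have -> : (fun m => X m j - X m ((s ^+ k.+1)%g j)) =
    (fun m => (X m j - X m ((s ^+ k)%g j)) +
              (X m ((s ^+ k)%g j) - X m (s ((s ^+ k)%g j)))).
    by apply/funext => m; rewrite expgSr permM addrA subrK.
  by rewrite -[0]addr0; apply: cvgD.
have mean m : cycle_mean (X m) = cycle_mean x.
  by elim: m => // m IHm; rewrite -IHm; exact: lazy_step_mean.
have N_neq0 : (#[s]%g)%:R != 0 :> R by rewrite pnatr_eq0 -lt0n order_gt0.
have XE m : X m j = cycle_mean x j +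
    (#[s]%g)%:R^-1 * \sum_(k < #[s]%g) (X m j - X m ((s ^+ k)%g j)).
  rewrite -(mean m) /cycle_mean sumrB sumr_const card_ord mulrBr subrKC.
  by rewrite -[X m j *+ _]mulr_natl mulKf.
rewrite -/X; under eq_fun do rewrite -/(X _) XE.
have lim :
  cycle_mean x j + (#[s]%g)%:R^-1 * (\sum_(k < #[s]%g) (X m j - X m ((s ^+ k)%g j)))
    @[m --> \oo] --> cycle_mean x j + (#[s]%g)%:R^-1 * (\sum_(k < #[s]%g) 0).
  apply: cvgD; first exact: cvg_cst.
  by apply: cvgMr; apply: cvg_big => [|k _]; first exact: add_continuous; exact: steps.
by move: lim; rewrite big1 // mulr0 addr0.
Qed.

End LazyWalk.

(** * Linear maps in an orthonormal basis *)

Lemma comp_idr (A B : Type) (f : A -> B) : f \o id = f.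
Proof. by []. Qed.

Lemma normcR (R : rcfType) (a : R) : `|a%:C%C| = `|a|%:C%C :> R[i].
Proof. by rewrite normc_def /= expr0n addr0 sqrtr_sqr. Qed.

Lemma gt0_complex (R : rcfType) (z : R[i]) : 0 < z ->
  z = (complex.Re z)%:C%C /\ 0 < complex.Re z.
Proof.
move=> z_gt0; have zE : (complex.Re z)%:C%C = z by rewrite RRe_real // gtr0_real.
by rewrite -ltcR zE.
Qed.

Lemma conj_real (R : realType) (a : R) : Num.conj (a%:C%C) = a%:C%C :> R[i].
Proof. by apply/CrealP/complex_realP; exists a. Qed.

Section Hilbert.
Variables (R : realType) (H : completeNormedModType R[i]).
Variable dot : {dot H for Num.conj}.
Implicit Types x y : H.

Lemma dotC x y : dot x y = Num.conj (dot y x).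
Proof. by rewrite hermC expr0 mul1r. Qed.

Lemma dotZl c x y : dot (c *: x) y = c * dot x y.
Proof. exact: linearZl_LR. Qed.

Lemma dotZr c x y : dot x (c *: y) = Num.conj c * dot x y.
Proof. exact: linearZr_LR. Qed.

Lemma dotNl x y : dot (- x) y = - dot x y.
Proof. exact: linearNl. Qed.

Lemma dotBl x y z : dot (x - y) z = dot x z - dot y z.
Proof. exact: linearBl. Qed.

Lemma dotBr x y z : dot x (y - z) = dot x y - dot x z.
Proof. exact: linearBr. Qed.

Lemma dot_suml (I : Type) (r : seq I) (P : pred I) (f : I -> H) y :
  dot (\sum_(i <- r | P i) f i) y = \sum_(i <- r | P i) dot (f i) y.
Proof. exact: linear_sumlz. Qed.

Lemma dot_ext x y : (forall z, dot x z = dot y z) -> x = y.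
Proof.
move=> xy; apply/eqP; rewrite -subr_eq0 -(dnorm_eq0 dot) linearBl /=.
by rewrite xy subrr.
Qed.

Lemma dot_extr x y : (forall z, dot z x = dot z y) -> x = y.
Proof. by move=> xy; apply: dot_ext => z; rewrite dotC xy -dotC. Qed.

(* [bounded_op] carries linearity as a proposition: the rules of linear maps are
   restated for a bare function. *)
Section LinearMap.
Variables (F : H -> H) (linF : linear F).

HB.instance Definition _ := GRing.isLinear.Build R[i] H H *:%R F linF.
Let F' : {linear H -> H} := F.

Lemma lin0 : F 0 = 0. Proof. exact: (linear0 F'). Qed.
Lemma linB x y : F (x - y) = F x - F y. Proof. exact: (linearB F'). Qed.
Lemma linZ c x : F (c *: x) = c *: F x. Proof. exact: (linearZ_LR F'). Qed.
Lemma lin_sum (I : Type) (r : seq I) (P : pred I) (f : I -> H) :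
  F (\sum_(i <- r | P i) f i) = \sum_(i <- r | P i) F (f i).
Proof. exact: (linear_sum F'). Qed.

Lemma lin_continuous (C : R[i]) : 0 <= C -> (forall x, `|F x| <= C * `|x|) -> continuous F.
Proof.
move=> C_ge0 bF; apply: (@bounded_linear_continuous _ _ _ F').
apply/linear_boundedP; exists C; split=> [|M CM x]; first exact: ger0_real.
by rewrite (le_trans (bF x)) // ler_wpM2r // ltW.
Qed.

Lemma continuous_lin_bound : continuous F ->
  exists2 C : R[i], 0 < C & forall x, `|F x| <= C * `|x|.
Proof.
move=> /(_ 0) F0.
have /linear_boundedP[M [Mreal FM]] := @continuous_linear_bounded _ _ _ 0 F' F0.
exists (`|M| + 1); first by rewrite ltr_wpDl.
apply: FM; rewrite (le_lt_trans (real_ler_norm Mreal)) // ltrDl //.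
Qed.

End LinearMap.

Lemma lin_comp (F G : H -> H) : linear F -> linear G -> linear (F \o G).
Proof. by move=> lF lG c x y; rewrite /= lG lF. Qed.

Lemma lin_iter (F : H -> H) k : linear F -> linear (iter k F).
Proof. by move=> lF; elim: k => //= k IHk c x y; rewrite /= IHk lF. Qed.

Definition orthobasis n (e : 'I_n -> H) : Prop :=
  (forall i j, dot (e i) (e j) = (i == j)%:R) /\
  (forall x, x = \sum_i dot x (e i) *: e i).

Section Orthobasis.
Variables (n : nat) (e : 'I_n -> H).
Hypothesis onb : orthobasis e.
Hypothesis hilbertH : hilbert_dot dot.

Lemma onb_coordE (c : 'I_n -> R[i]) j : dot (\sum_i c i *: e i) (e j) = c j.
Proof.
rewrite linear_sumlz /= (bigD1 j) //= dotZl onb.1 eqxx mulr1 big1 ?addr0 //.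
by move=> i ij; rewrite dotZl onb.1 (negPf ij) mulr0.
Qed.

Lemma onb_coordE2 (c : 'I_n -> R[i]) x :
  dot (\sum_i c i *: e i) x = \sum_i c i * Num.conj (dot x (e i)).
Proof.
by rewrite linear_sumlz /=; apply: eq_bigr => i _; rewrite dotZl dotC.
Qed.

Lemma parseval x y : dot x y = \sum_i dot x (e i) * Num.conj (dot y (e i)).
Proof. by rewrite {1}[x]onb.2 onb_coordE2. Qed.

Lemma onb_ext x y : (forall i, dot x (e i) = dot y (e i)) -> x = y.
Proof. by move=> xy; rewrite [x]onb.2 [y]onb.2; apply: eq_bigr => i _; rewrite xy. Qed.

Lemma lin_ext (F G : H -> H) : linear F -> linear G ->
  (forall i, F (e i) = G (e i)) -> F = G.
Proof.
move=> lF lG FG; apply/funext => x; rewrite [x]onb.2 !lin_sum //.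
by apply: eq_bigr => i _; rewrite !linZ // FG.
Qed.

Lemma norm_e i : `|e i| = 1.
Proof.
apply/eqP; rewrite -(@pexpr_eq1 _ _ 2) // hilbertH onb.1 eqxx //.
Qed.

Lemma coord_le_norm x i : `|dot x (e i)| <= `|x|.
Proof.
rewrite -(@ler_pXn2r _ 2) ?nnegrE // hilbertH [leRHS]parseval (bigD1 i) // -normCK lerDl.
by apply: sumr_ge0 => j _; rewrite mul_conjC_ge0.
Qed.

Lemma entries_bound (F : H -> H) (C : R[i]) : linear F ->
  (forall i j, `|dot (F (e j)) (e i)| <= C) ->
  forall x, `|F x| <= (n * n)%:R * C * `|x|.
Proof.
move=> lF FC x.
have col j : `|F (e j)| <= n%:R * C.
  rewrite [F _]onb.2 (le_trans (ler_norm_sum _ _ _)) //.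
  rewrite mulr_natl -[n in _ *+ n]card_ord -sumr_const ler_sum // => i _.
  by rewrite normrZ norm_e mulr1.
rewrite {1}[x]onb.2 lin_sum // (le_trans (ler_norm_sum _ _ _)) //.
rewrite natrM -mulrA -mulrA mulr_natl -[n in _ *+ n]card_ord -sumr_const.
rewrite ler_sum // => i _; rewrite linZ // normrZ mulrC mulrA.
apply: ler_pM => //; exact: coord_le_norm.
Qed.

(** The form in which [entries_bound] is applied to the error of an approximation;
    the [+ 1] keeps the denominator nonzero when [n = 0]. *)
Lemma small_entries (eps : R[i]) (F : H -> H) : 0 < eps -> linear F ->
  (forall i j, `|dot (F (e j)) (e i)| <= (complex.Re eps / ((n * n)%:R + 1))%:C%C) ->
  forall x, `|F x| <= eps * `|x|.
Proof.
move=> /gt0_complex[epsE r_gt0] lF small x.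
apply: le_trans (entries_bound lF small x) _.
have M_gt0 : 0 < (n * n)%:R + 1 :> R by rewrite ltr_wpDl.
rewrite ler_wpM2r // [leRHS]epsE -(rmorph_nat (real_complex R)) -rmorphM /= lecR.
by rewrite mulrCA ler_piMr ?(ltW r_gt0) // ler_pdivrMr // mul1r lerDl.
Qed.

Lemma lin_bounded_op (F : H -> H) : linear F -> bounded_op F.
Proof.
move=> lF; split=> //.
pose C := \sum_i \sum_j `|dot (F (e j)) (e i)|.
apply: (@lin_continuous _ lF ((n * n)%:R * C)).
  by rewrite mulr_ge0 // sumr_ge0 // => i _; exact: sumr_ge0.
apply: entries_bound => // i j.
rewrite /C (bigD1 i) //= (bigD1 j) //= -addrA lerDl addr_ge0 ?sumr_ge0 // => *.
by rewrite sumr_ge0.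
Qed.

Definition adj_op (F : H -> H) : H -> H :=
  fun y => \sum_i dot y (F (e i)) *: e i.

Lemma adj_op_lin F : linear (adj_op F).
Proof.
move=> c x y; rewrite /adj_op scaler_sumr -big_split /=; apply: eq_bigr => i _.
by rewrite linearDl /= dotZl scalerDl scalerA.
Qed.

Lemma adj_opP F x y : linear F -> dot (F x) y = dot x (adj_op F y).
Proof.
move=> lF; rewrite [RHS]dotC onb_coordE2 rmorph_sum /=.
rewrite {1}[x]onb.2 lin_sum // linear_sumlz /=; apply: eq_bigr => i _.
by rewrite linZ // dotZl rmorphM /= -dotC conjCK mulrC.
Qed.

(** The form separates points, so that its values determine the adjoint. *)
Lemma adj_uniq F G : linear F -> linear G ->
  (forall x y, dot (F x) y = dot x (G y)) -> adj dot F = G.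
Proof.
move=> lF lG FG.
have ex : [set S | bounded_op S /\ forall x y, dot (F x) y = dot x (S y)] G.
  by split=> //; exact: lin_bounded_op.
have [_ adjP] := getPex (ex_intro _ G ex).
by apply/funext => y; apply: dot_extr => z; rewrite -FG -adjP.
Qed.

Lemma adjE F : linear F -> adj dot F = adj_op F.
Proof.
by move=> lF; apply: adj_uniq => //; [exact: adj_op_lin | move=> *; exact: adj_opP].
Qed.

Lemma adjP F : linear F ->
  linear (adj dot F) /\ forall x y, dot (F x) y = dot x (adj dot F y).
Proof.
by move=> lF; rewrite adjE //; split; [exact: adj_op_lin | move=> x y; exact: adj_opP].
Qed.

Definition diag_op (d : 'I_n -> R) : H -> H :=
  fun x => \sum_i ((d i)%:C%C * dot x (e i)) *: e i.

Lemma diag_op_lin d : linear (diag_op d).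
Proof.
move=> c x y; rewrite /diag_op scaler_sumr -big_split /=; apply: eq_bigr => i _.
by rewrite linearDl /= dotZl mulrDr scalerDl scalerA mulrCA.
Qed.

Lemma diag_op_coord d x i : dot (diag_op d x) (e i) = (d i)%:C%C * dot x (e i).
Proof. exact: onb_coordE. Qed.

Lemma diag_op_e d i : diag_op d (e i) = (d i)%:C%C *: e i.
Proof.
apply: onb_ext => j; rewrite diag_op_coord dotZl onb.1.
by case: eqVneq => [->|] //; rewrite !mulr0.
Qed.

Lemma diag_op_adj d x y : dot (diag_op d x) y = dot x (diag_op d y).
Proof.
rewrite !parseval; apply: eq_bigr => i _.
by rewrite !diag_op_coord rmorphM /= conj_real mulrCA mulrA.
Qed.

Lemma adj_diag d : adj dot (diag_op d) = diag_op d.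
Proof. by apply: adj_uniq; [exact: diag_op_lin..|exact: diag_op_adj]. Qed.

Lemma diag_op_comp d d' : diag_op d \o diag_op d' = diag_op (fun i => d i * d' i).
Proof.
apply/funext => x; apply: onb_ext => i; rewrite /= !diag_op_coord.
by rewrite rmorphM mulrA.
Qed.

Lemma diag_op_eigen (F : H -> H) d : linear F ->
  (forall i, F (e i) = (d i)%:C%C *: e i) -> F = diag_op d.
Proof.
move=> lF Fe; apply: lin_ext => // [|i]; first exact: diag_op_lin.
by rewrite diag_op_e.
Qed.

End Orthobasis.
End Hilbert.

(** * Simultaneous diagonalization *)

(** The ranks of the matrices of the first [N] terms increase and are bounded, so
    that some [N] has the maximal rank. *)
Lemma seq_span (K : fieldType) m (v : nat -> 'rV[K]_m) :
  exists N, forall k, exists c : 'I_N -> K, v k = \sum_i c i *: v i.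
Proof.
pose B N := \matrix_(i < N) v i.
pose is_rank r := [exists i : 'I_m.+1, `[< exists N, \rank (B N) = i >] && (r == i :> nat)].
have exN : exists r, is_rank r.
  have lt0 : (\rank (B 0) < m.+1)%N by rewrite ltnS rank_leq_col.
  exists (\rank (B 0)); apply/existsP; exists (Ordinal lt0); rewrite eqxx andbT.
  by apply/asboolP; exists 0%N.
have r_le r : is_rank r -> (r <= m)%N.
  by move=> /existsP[i /andP[_ /eqP->]]; rewrite -ltnS.
have [r] := ex_maxnP exN r_le.
move=> /existsP[i /andP[/asboolP[N rN] /eqP ri]] rmax.
exists N => k.
have subB M : (N <= M)%N -> (B N <= B M)%MS.
  move=> NM; apply/row_subP => j; rewrite rowK.
  have -> : v j = row (widen_ord NM j) (B M) by rewrite rowK.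
  exact: row_sub.
have : (v k <= B N)%MS.
  pose M := maxn N k.+1.
  have NM : (N <= M)%N by rewrite leq_maxl.
  have kM : (k < M)%N by rewrite leq_maxr.
  have rM : (\rank (B M) <= \rank (B N))%N.
    rewrite rN -ri; apply: rmax.
    have ltM : (\rank (B M) < m.+1)%N by rewrite ltnS rank_leq_col.
    apply/existsP; exists (Ordinal ltM); rewrite eqxx andbT.
    by apply/asboolP; exists M.
  have /mxrank_leqif_sup[le_r eq_r] := subB _ NM.
  have -> : v k = row (Ordinal kM) (B M) by rewrite rowK.
  apply: submx_trans (row_sub _ _) _.
  by rewrite -eq_r eqn_leq le_r rM.
move=> /submxP[D vD]; exists (D 0); rewrite {1}vD mulmx_sum_row.
by apply: eq_bigr => j _; rewrite rowK.
Qed.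

Section Diagonalization.
Variables (R : realType) (H : completeNormedModType R[i]).
Variable dot : {dot H for Num.conj}.
Variables (n : nat) (e : 'I_n -> H).
Hypothesis onb : orthobasis dot e.

Local Open Scope sesquilinear_scope.

(* A matrix acts on coordinates written as row vectors. *)
Definition basis_change (P : 'M[R[i]]_n) : 'I_n -> H := fun p => \sum_i P p i *: e i.

Lemma basis_change_dot P p x :
  dot x (basis_change P p) = \sum_i dot x (e i) * Num.conj (P p i).
Proof.
rewrite dotC (onb_coordE2 dot) rmorph_sum /=; apply: eq_bigr => i _.
by rewrite rmorphM /= conjCK mulrC.
Qed.

Lemma basis_change_onb P : P \is unitarymx -> orthobasis dot (basis_change P).
Proof.
move=> uP; split=> [p q|x].
  rewrite basis_change_dot; under eq_bigr do rewrite onb_coordE //.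
  have /matrixP/(_ p q) := unitarymxP uP.
  by rewrite !mxE => <-; apply: eq_bigr => i _; rewrite !mxE.
apply: (onb_ext onb) => j; rewrite linear_sumlz /=.
under eq_bigr do rewrite dotZl onb_coordE // basis_change_dot mulr_suml.
rewrite exchange_big /=.
have /unitarymxP : P^t* \is unitarymx by rewrite trmxC_unitary.
rewrite trmxCK => /matrixP PP.
have PPij i : \sum_p Num.conj (P p i) * P p j = (i == j)%:R.
  by have := PP i j; rewrite !mxE => <-; apply: eq_bigr => p _; rewrite !mxE.
under eq_bigr => i _.
  under eq_bigr do rewrite -mulrA.
  rewrite -mulr_sumr PPij.
  over.
rewrite (bigD1 j) //= eqxx mulr1 big1 ?addr0 // => i /negPf ->.
by rewrite mulr0.
Qed.

Definition entries (F : H -> H) : 'M[R[i]]_n := \matrix_(i, j) dot (F (e i)) (e j).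

Lemma entries_comp F G : linear F -> linear G ->
  entries (F \o G) = entries G *m entries F.
Proof.
move=> lF lG; apply/matrixP => i j; rewrite !mxE /= {1}[G _]onb.2 lin_sum //.
by rewrite linear_sumlz /=; apply: eq_bigr => k _; rewrite linZ // dotZl !mxE.
Qed.

Lemma basis_change_entries P F p q : linear F ->
  dot (F (basis_change P p)) (basis_change P q) = (P *m entries F *m P^t*) p q.
Proof.
move=> lF; rewrite basis_change_dot mxE; apply: eq_bigr => j _.
rewrite !mxE; congr (_ * _).
by rewrite lin_sum // linear_sumlz /=; apply: eq_bigr => i _; rewrite linZ // dotZl !mxE.
Qed.

(** Finitely many of the operators span all of them, and commuting matrices are
    simultaneously triangular in some orthonormal basis; a hermitian triangular
    matrix is diagonal. *)
Lemma codiagonalization (F : nat -> H -> H) :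
  (forall k, linear (F k)) ->
  (forall k x y, dot (F k x) y = dot x (F k y)) ->
  (forall k l, F k \o F l = F l \o F k) ->
  exists e' : 'I_n -> H, orthobasis dot e' /\
    exists d : nat -> 'I_n -> R, forall k, F k = diag_op dot e' (d k).
Proof.
move=> linF adjF commF.
pose M k := entries (F k).
have [N spanN] := seq_span (fun k => mxvec (M k)).
have [|P uP /allP trigP] := @cotrigonalization _ _ [seq M (val i) | i <- enum 'I_N].
  move=> _ _ /mapP[k _ ->] /mapP[l _ ->].
  by rewrite /comm_mx /M -!entries_comp // commF.
pose D k := P *m M k *m P^t*.
have M_herm k : (M k)^t* = M k.
  by apply/matrixP => i j; rewrite !mxE -dotC adjF.
have D_herm k i j : Num.conj (D k j i) = D k i j.
  have : (D k)^t* = D k.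
    by rewrite /D !trmx_mul !map_mxM trmxCK M_herm mulmxA.
  by move=> /matrixP/(_ i j) <-; rewrite !mxE.
have D_diagN k i j : (k < N)%N -> i != j -> D k i j = 0.
  move=> kN; have trig (p q : 'I_n) : (p < q)%N -> D k p q = 0.
    move=> pq; have /trigP : M k \in [seq M (val i) | i <- enum 'I_N].
      by apply/mapP; exists (Ordinal kN); rewrite ?mem_enum.
    rewrite /= /similar_to conjymx //.
    by move=> /is_trig_mxP; apply.
  rewrite neq_ltn => /orP[/trig//|/trig ji].
  by rewrite -D_herm ji conjC0.
have D_diag k i j : i != j -> D k i j = 0.
  move=> ij; have [c /(congr1 vec_mx)] := spanN k.
  rewrite mxvecK linear_sum /= => Mk.
  rewrite /D Mk mulmx_sumr mulmx_suml summxE big1 // => l _.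
  by rewrite linearZ /= mxvecK -scalemxAr -scalemxAl mxE D_diagN ?mulr0.
exists (basis_change P); split; first exact: basis_change_onb.
exists (fun k p => complex.Re (D k p p)) => k.
have onb' := basis_change_onb uP.
apply: (diag_op_eigen onb') => // p; apply: (onb_ext onb') => q.
rewrite basis_change_entries // -/(M k) -/(D k) dotZl onb'.1.
have [<-|pq] := eqVneq p q; last first.
  by rewrite mulr0 D_diag.
by rewrite mulr1 RRe_real //; apply/CrealP; rewrite D_herm.
Qed.

End Diagonalization.

(** * Polar decomposition *)

Section Polar.
Variables (R : realType) (H : completeNormedModType R[i]).
Variable dot : {dot H for Num.conj}.
Hypothesis hilbertH : hilbert_dot dot.

Definition unitary_op (U : H -> H) : Prop :=
  [/\ linear U, adj dot U \o U = id & U \o adj dot U = id].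

Variables (n : nat) (e : 'I_n -> H).
Hypothesis onb : orthobasis dot e.

Let adjP' (F : H -> H) (lF : linear F) := adjP onb hilbertH lF.

Lemma unitary_adj_lin U : unitary_op U -> linear (adj dot U).
Proof. by case=> lU _ _; exact: (adjP' lU).1. Qed.

Lemma unitary_dot U x y : unitary_op U -> dot (U x) (U y) = dot x y.
Proof.
case=> lU UU _; rewrite (adjP' lU).2.
by have /(congr1 (@^~ y)) /= -> := UU.
Qed.

Lemma diag_op_inv (g : 'I_n -> R) : (forall i, g i != 0) ->
  diag_op dot e g \o diag_op dot e (fun i => (g i)^-1) = id.
Proof.
move=> g0; rewrite (diag_op_comp onb); apply/funext => x; apply: (onb_ext onb) => i.
by rewrite diag_op_coord // mulfV // rmorph1 mul1r.
Qed.

Lemma diag_op_inj (g : 'I_n -> R) x : (forall i, g i != 0) ->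
  diag_op dot e g x = 0 -> x = 0.
Proof.
move=> g0 gx; apply: (onb_ext onb) => i; rewrite linear0l.
have /eqP := congr1 (dot^~ (e i)) gx.
rewrite /= diag_op_coord // linear0l mulf_eq0 => /orP[/eqP g0i|/eqP//].
by have := g0 i; rewrite (complexI g0i) eqxx.
Qed.

Lemma diag_op_pos (g : 'I_n -> R) : (forall i, 0 <= g i) ->
  positive_op dot (diag_op dot e g).
Proof.
move=> g0; split; first by apply: (lin_bounded_op onb hilbertH); exact: diag_op_lin.
move=> x; rewrite (parseval onb); apply: sumr_ge0 => i _.
by rewrite diag_op_coord // -mulrA mulr_ge0 ?ler0c // mul_conjC_ge0.
Qed.

(** Uniqueness of the positive square root: if [A (A x) = g^2 x] with [g > 0], then
    [y = A x - g x] satisfies [A y = - g y], which positivity of [A] allows only for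
    [y = 0]. *)
Lemma positive_sqrt_uniq (A : H -> H) (g : 'I_n -> R) : (forall i, 0 < g i) ->
  positive_op dot A -> A \o A = diag_op dot e (fun i => g i ^+ 2) ->
  A = diag_op dot e g.
Proof.
move=> g_gt0 [[lA _] A_ge0] AA.
apply: (diag_op_eigen onb) => // i.
pose y := A (e i) - (g i)%:C%C *: e i.
have Ay : A y = - ((g i)%:C%C *: y).
  rewrite /y linB // linZ //.
  have /(congr1 (@^~ (e i))) /= -> := AA.
  rewrite diag_op_e // scalerBr scalerA opprB rmorphXn /= expr2.
  by rewrite addrC.
have := A_ge0 y; rewrite Ay dotNl dotZl oppr_ge0 => le0.
have y0 : dot y y = 0.
  apply/eqP; rewrite eq_le dnorm_ge0 andbT.
  by rewrite -(pmulr_rle0 _ (_ : 0 < (g i)%:C%C)) // ltcR.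
by apply/eqP; rewrite -subr_eq0 -/y -(dnorm_eq0 dot) y0.
Qed.

(** The factors of a product of a unitary and a positive invertible operator are
    recovered by [phase] and [abs_op]: the second one as a square root, the first
    one because a diagonal operator with positive entries is onto. *)
Lemma polar_diag (U : H -> H) (g : 'I_n -> R) : (forall i, 0 < g i) -> unitary_op U ->
  abs_op dot (U \o diag_op dot e g) = diag_op dot e g /\
  phase dot (U \o diag_op dot e g) = U.
Proof.
move=> g_gt0 uU; have [lU UU1 UU2] := uU.
set D := diag_op dot e g; set T := U \o D.
have lD : linear D by exact: diag_op_lin.
have lT : linear T by exact: lin_comp.
have g_neq0 i : g i != 0 by rewrite gt_eqF.
have lUa := unitary_adj_lin uU.
have TT : adj dot T \o T = diag_op dot e (fun i => g i ^+ 2).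
  have -> : adj dot T = D \o adj dot U.
    apply: (adj_uniq onb hilbertH) => //; first exact: lin_comp.
    by move=> x y; rewrite /= (adjP' lU).2 (diag_op_adj onb).
  by rewrite /T compA -[_ \o U]compA UU1 comp_idr /D (diag_op_comp onb).
have absT : abs_op dot T = D.
  have exA : [set A | positive_op dot A /\ A \o A = adj dot T \o T] D.
    split; first by apply: diag_op_pos => i; rewrite ltW.
    by rewrite TT /D (diag_op_comp onb).
  have [posA AA] := getPex (ex_intro _ D exA).
  exact: (positive_sqrt_uniq g_gt0 posA (etrans AA TT)).
split=> //.
have exU : [set V | [/\ bounded_op V, V \o adj dot V \o V = V,
    forall x, V x = 0 <-> T x = 0 & T = V \o abs_op dot T]] U.
  split.
  - exact: (lin_bounded_op onb).
  - by rewrite UU2.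
  - move=> x; split=> [Ux0|Tx0].
      have -> : x = 0 by have /(congr1 (@^~ x)) /= <- := UU1; rewrite Ux0 lin0.
      exact: lin0.
    have Dx0 : D x = 0.
      by have /(congr1 (@^~ (D x))) /= <- := UU1; rewrite -/(T x) [U _]Tx0 lin0.
    by rewrite (diag_op_inj g_neq0 Dx0) lin0.
  - by rewrite absT.
have [_ _ _] := getPex (ex_intro _ U exU).
rewrite -/(phase dot T) absT => UD; apply/funext => x.
have /(congr1 (@^~ x)) /= DDx := diag_op_inv g_neq0.
by rewrite -DDx -/D -[LHS]/((phase dot T \o D) _) -UD.
Qed.

(** Diagonalize [T^* T], whose eigenvalues [|T e|^2] are positive because [T] is
    injective; then [U] is [T] followed on the right by [|T|^-1]. *)
Lemma polar_exists (T : H -> H) : bounded_op T -> invertible_op T ->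
  exists e' U g, [/\ orthobasis dot e', unitary_op U, forall i : 'I_n, 0 < g i &
    T = U \o diag_op dot e' g].
Proof.
move=> [lT _] [S [[lS _] ST TS]].
have [lTa adjT] := adjP' lT.
have lTT : linear (adj dot T \o T) by exact: lin_comp.
have TTadj x y : dot ((adj dot T \o T) x) y = dot x ((adj dot T \o T) y).
  by rewrite /= dotC -adjT -dotC adjT.
have [e' [onb' [d /(_ 0%N) TTd]]] :=
  @codiagonalization _ _ _ _ _ onb (fun=> adj dot T \o T) (fun=> lTT) (fun=> TTadj)
    (fun _ _ => erefl).
have injT x : T x = 0 -> x = 0.
  by move=> Tx0; have /(congr1 (@^~ x)) /= <- := ST; rewrite Tx0 lin0.
have dE i : dot (T (e' i)) (T (e' i)) = (d 0%N i)%:C%C.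
  rewrite adjT -[adj dot T _]/((adj dot T \o T) (e' i)) TTd.
  by rewrite diag_op_e // dotZr onb'.1 eqxx mulr1 conj_real.
have d_gt0 i : 0 < d 0%N i.
  rewrite -ltcR -dE dnorm_gt0; apply/eqP => /injT e0.
  by have := onb'.1 i i; rewrite e0 linear0l eqxx => /esym/eqP; rewrite oner_eq0.
pose g i := Num.sqrt (d 0%N i).
have g_gt0 i : 0 < g i by rewrite sqrtr_gt0.
have g_neq0 i : g i != 0 by rewrite gt_eqF.
pose D := diag_op dot e' g; pose D' := diag_op dot e' (fun i => (g i)^-1).
have lD' : linear D' by exact: diag_op_lin.
have D'D : D' \o D = id.
  rewrite (diag_op_comp onb'); apply/funext => x; apply: (onb_ext onb') => i.
  by rewrite diag_op_coord // mulVf // rmorph1 mul1r.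
have DD' : D \o D' = id.
  rewrite (diag_op_comp onb'); apply/funext => x; apply: (onb_ext onb') => i.
  by rewrite diag_op_coord // mulfV // rmorph1 mul1r.
have DD : adj dot T \o T = D \o D.
  rewrite TTd (diag_op_comp onb'); congr (diag_op _ _ _); apply/funext => i.
  by rewrite -expr2 sqr_sqrtr // ltW.
exists e', (T \o D'), g; split=> //; last by rewrite -compA -/D D'D comp_idr.
have lU : linear (T \o D') by exact: lin_comp.
have aU : adj dot (T \o D') = D' \o adj dot T.
  apply: (adj_uniq onb hilbertH) => //; first exact: lin_comp.
  by move=> x y; rewrite /= adjT (diag_op_adj onb').
have left : (D' \o adj dot T) \o (T \o D') = id.
  rewrite compA -[D' \o _ \o T]compA DD -compA -[D \o D \o D']compA DD' comp_idr.
  exact: D'D.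
split=> //; rewrite aU //.
(* [T] is onto, so that the left inverse is a right inverse *)
apply/funext => x /=.
have Ty : T (D' (D (S x))) = x.
  have /(congr1 (@^~ (S x))) /= -> := D'D.
  by have /(congr1 (@^~ x)) /= -> := TS.
have /(congr1 (@^~ (D (S x)))) /= := left.
by rewrite Ty => ->.
Qed.

End Polar.

(** * Resolutions of the identity of a diagonal operator *)

Section Partitions.
Variable R : realType.
Implicit Types (a b d : R) (s t : seq R) (h : R -> R).

Lemma telescope_partition (V : zmodType) (h : R -> V) a b s : itv_partition a b s ->
  \sum_(i < size s) (h s`_i - h (a :: s)`_i) = h b - h a.
Proof.
case=> _ /eqP <-; rewrite -(big_mkord xpredT (fun i => h s`_i - h (a :: s)`_i)).
rewrite (telescope_sumr (fun i => h (a :: s)`_i)) //=.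
by rewrite -[last a s]/(last 0 (a :: s)) -nth_last.
Qed.

(** Only the intervals on which [h] increases contribute to the sum. *)
Lemma stieltjes_sum_le h a b d s t M : {homo h : x y / x <= y} ->
  tagged_partition a b d s t ->
  (forall i, (i < size s)%N -> h s`_i != h (a :: s)`_i -> t`_i <= M) ->
  \sum_(i < size s) t`_i * (h s`_i - h (a :: s)`_i) <= M * (h b - h a).
Proof.
move=> hh [ps _ tag] tM; rewrite -(telescope_partition h ps) mulr_sumr.
apply: ler_sum => i _; have [<-|ne] := eqVneq (h s`_i) (h (a :: s)`_i).
  by rewrite subrr !mulr0.
apply: ler_wpM2r; last exact: tM.
have [/andP[l1 l2] _] := tag i (ltn_ord i).
by rewrite subr_ge0; apply: hh; exact: le_trans l2.
Qed.

Lemma stieltjes_sum_ge h a b d s t M : {homo h : x y / x <= y} ->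
  tagged_partition a b d s t ->
  (forall i, (i < size s)%N -> h s`_i != h (a :: s)`_i -> M <= t`_i) ->
  M * (h b - h a) <= \sum_(i < size s) t`_i * (h s`_i - h (a :: s)`_i).
Proof.
move=> hh [ps _ tag] tM; rewrite -(telescope_partition h ps) mulr_sumr.
apply: ler_sum => i _; have [<-|ne] := eqVneq (h s`_i) (h (a :: s)`_i).
  by rewrite subrr !mulr0.
apply: ler_wpM2r; last exact: tM.
have [/andP[l1 l2] _] := tag i (ltn_ord i).
by rewrite subr_ge0; apply: hh; exact: le_trans l2.
Qed.

Lemma tagged_partition_exists a b d : a < b -> 0 < d ->
  exists s t, tagged_partition a b d s t.
Proof.
move=> ab d_gt0.
suff: exists s, tagged_partition a b d s s by case=> s; exists s, s.
have [N ltN] : exists N, b - a < N.+1%:R * d.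
  exists (Num.truncn ((b - a) / d)); rewrite -ltr_pdivrMr //.
  by rewrite truncnS_gt.
elim: N a ab ltN => [|N IHN] a ab ltN.
  exists [:: b]; split=> //; first exact: itv_partition1.
  by case=> //= _; rewrite lexx ltW //; rewrite mul1r in ltN.
pose a' := a + (b - a) / N.+2%:R.
have ba_gt0 : 0 < b - a by rewrite subr_gt0.
have N_gt0 : 0 < N.+2%:R :> R by [].
have aa' : a < a' by rewrite ltrDl divr_gt0.
have a'd : a' - a < d by rewrite /a' addrC addKr ltr_pdivrMr // mulrC.
have a'E : b - a' = (b - a) / N.+2%:R * N.+1%:R.
  rewrite /a'; have -> : N.+2%:R = N.+1%:R + 1 :> R by rewrite natr1.
  by field; rewrite [1 + _]addrC !natr1 pnatr_eq0.
have a'b : a' < b by rewrite -subr_gt0 a'E mulr_gt0 // divr_gt0.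
have [|s [ps _ tag]] := IHN a' a'b.
  by rewrite a'E mulrC ltr_pM2l // ltr_pdivrMr // mulrC.
exists (a' :: s); split=> //.
  by case: ps => ps /eqP sb; split => //=; [rewrite aa'|apply/eqP].
by case=> [_|i /tag] //=; rewrite lexx ltW.
Qed.

Lemma tagged_partition_le a b d d' s t : d <= d' ->
  tagged_partition a b d s t -> tagged_partition a b d' s t.
Proof.
move=> dd' [ps st tag]; split=> // i /tag[ti si]; split=> //.
exact: lt_le_trans si dd'.
Qed.

End Partitions.

Section Resolution.
Variables (R : realType) (H : completeNormedModType R[i]).
Variable dot : {dot H for Num.conj}.
Hypothesis hilbertH : hilbert_dot dot.
Variables (n : nat) (e : 'I_n -> H).
Hypothesis onb : orthobasis dot e.

(** Cauchy-Schwarz: [|x - c y|^2 >= 0] for [c y] the projection of [x] on [y]. *)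
Lemma norm_dot_le x y : `|dot x y| <= `|x| * `|y|.
Proof.
have [->|y0] := eqVneq y 0; first by rewrite linear0r !normr0 mulr0.
have yy : 0 < dot y y by rewrite dnorm_gt0.
pose c := dot x y / dot y y.
have : 0 <= dot (x - c *: y) (x - c *: y) by exact: dnorm_ge0.
rewrite dotBl !dotBr !dotZl !dotZr.
have -> : dot y x = Num.conj (dot x y) by exact: dotC.
have yr : Num.conj (dot y y)^-1 = (dot y y)^-1.
  by apply/CrealP; rewrite realV gtr0_real.
have -> : Num.conj c = Num.conj (dot x y) / dot y y.
  by rewrite /c rmorphM /= yr.
have -> : c * (Num.conj (dot x y) / dot y y * dot y y) = c * Num.conj (dot x y).
  by rewrite divfK // gt_eqF.
rewrite subrr subr0 subr_ge0 mulrAC [Num.conj _ * _]mulrC -normCK ler_pdivrMr // => le.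
rewrite -(@ler_pXn2r _ 2) ?nnegrE ?mulr_ge0 // exprMn.
by rewrite ![`|_ : H| ^+ 2]hilbertH.
Qed.

Section Eigen.
Variables (g : 'I_n -> R) (a b : R) (E : R -> H -> H).
Hypothesis resE : spectral_resolution dot (diag_op dot e g) a b E.

Let linE s : linear (E s).
Proof. by case: (resolution_proj resE s) => [[]]. Qed.

Let adjE' s x y : dot (E s x) y = dot x (E s y).
Proof.
have [_ _ aE] := resolution_proj resE s.
by rewrite (adjP onb hilbertH (linE s)).2 aE.
Qed.

Lemma resolution_min s t x : E s (E t x) = E (Num.min s t) x.
Proof.
have [st|/ltW ts] := leP s t.
  by have /(congr1 (@^~ x)) := resolution_mono resE st.
apply: (@dot_ext _ _ dot) => y; rewrite !adjE'.
by have /(congr1 (@^~ y)) /= -> := resolution_mono resE ts.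
Qed.

Variable x : H.
Hypothesis norm_x : `|x| = 1.

Let dotx : dot x x = 1. Proof. by rewrite -hilbertH norm_x expr1n. Qed.

(* The distribution function of the spectral measure at the unit vector [x]. *)
Let m s := complex.Re (dot (E s x) x).

Let dot_proj s t : dot (E s x) (E t x) = dot (E (Num.min s t) x) x.
Proof. by rewrite -adjE' resolution_min minC. Qed.

Let mE s : dot (E s x) x = (m s)%:C%C.
Proof.
rewrite /m RRe_real // ger0_real //.
by rewrite -[s]minxx -dot_proj dnorm_ge0.
Qed.

Let m_ge0 s : 0 <= m s.
Proof. by rewrite -ler0c -mE -[s]minxx -dot_proj dnorm_ge0. Qed.

Let m_le s t : s <= t -> m s <= m t.
Proof.
move=> st; rewrite -subr_ge0 -ler0c rmorphB /= -!mE.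
have := dnorm_ge0 dot (E t x - E s x).
rewrite dotBl !dotBr !dot_proj !minxx min_r // [Num.min s t]min_l //.
by rewrite subrr subr0.
Qed.

Let m_le1 s : m s <= 1.
Proof.
rewrite -subr_ge0 -ler0c rmorphB /= -mE rmorph1 -dotx.
have := dnorm_ge0 dot (x - E s x).
by rewrite dotBl !dotBr dot_proj minxx -adjE' subrr subr0.
Qed.

Let norm_proj s : `|E s x| <= 1.
Proof.
rewrite -(@ler_pXn2r _ 2) ?nnegrE // expr1n hilbertH dot_proj minxx mE.
by rewrite lecR.
Qed.

Variable alpha : R.
Hypothesis eigen_x : diag_op dot e g x = alpha%:C%C *: x.

(* Since [x] is an eigenvector, [dot (A y) x] is [alpha * h b], and the sums
   of [A y] against [x] are Stieltjes sums for [h].  The bound [2] allows for both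
   [y = E s x] and [y = x - E s x]. *)
Let sum_approx y (h : R -> R) : (forall s, dot (E s y) x = (h s)%:C%C) ->
  `|y| <= 2 -> forall eps : R, 0 < eps -> exists2 d, 0 < d & forall s t,
  tagged_partition a b d s t ->
  `|\sum_(i < size s) t`_i * (h s`_i - h (a :: s)`_i) - alpha * (h b)| <= eps.
Proof.
move=> hE y2 eps eps_gt0.
have e2_gt0 : 0 < (eps / 2)%:C%C by rewrite ltcR divr_gt0.
have [d d_gt0 dP] := resolution_integral resE e2_gt0.
exists d => // s t /dP/(_ y) le; rewrite -lecR -normcR.
have -> : (\sum_(i < size s) t`_i * (h s`_i - h (a :: s)`_i) - alpha * h b)%:C%C =
  dot (\sum_(i < size s) (t`_i)%:C%C *: increment E a s i y - diag_op dot e g y) x.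
  rewrite dotBl (diag_op_adj onb) eigen_x dotZr conj_real.
  have := hE b; rewrite (resolution_right resE) => ->.
  rewrite rmorphB rmorphM rmorph_sum dot_suml; congr (_ - _).
  apply: eq_bigr => i _.
  by rewrite dotZl rmorphM rmorphB /= -!hE /increment dotBl.
apply: le_trans (norm_dot_le _ _) _.
rewrite norm_x mulr1 (le_trans le) //.
rewrite (le_trans (ler_wpM2l (ltW e2_gt0) y2)) //.
by rewrite -[2]/(2%:R) -(rmorph_nat (real_complex R)) -rmorphM /= lecR divfK.
Qed.

(** Take [y = E s x]: its distribution function is constant beyond [s], so that the
    sums are at most about [s * m s], while they approximate [alpha * m s]. *)
Lemma resolution_below s : s < alpha -> E s x = 0.
Proof.
move=> s_lt; suff ms0 : m s <= 0.
  apply/eqP; rewrite -(dnorm_eq0 dot) dot_proj minxx mE.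
  by have -> : m s = 0 by apply/eqP; rewrite eq_le ms0 m_ge0.
rewrite leNgt; apply/negP => ms_gt0.
pose h u := m (Num.min u s).
have hE u : dot (E u (E s x)) x = (h u)%:C%C by rewrite resolution_min mE.
have h_le : {homo h : u v / u <= v}.
  by move=> u v uv; apply: m_le; rewrite le_min !ge_min uv lexx orbT.
(* with [c = (alpha - s) / 3], the mesh is at most [c] and the error at most
   [c * m s]: then [(alpha - c) * m s <= (s + c) * m s], which is absurd *)
have c_gt0 : 0 < (alpha - s) / 3 by rewrite divr_gt0 // subr_gt0.
have c'_gt0 : 0 < (alpha - s) / 3 * m s by rewrite mulr_gt0.
have n2 : `|E s x| <= 2 by rewrite (le_trans (norm_proj s)) // ler1n.
have [d d_gt0 dP] := sum_approx hE n2 c'_gt0.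
pose d' := Num.min d ((alpha - s) / 3).
have d'_gt0 : 0 < d' by rewrite lt_min d_gt0.
have [u [v part]] := tagged_partition_exists (resolution_lt resE) d'_gt0.
have := dP _ _ (tagged_partition_le (_ : d' <= d) part).
rewrite ge_min lexx => /(_ isT).
have hb : h b = m s.
  by apply: complexI; rewrite -hE (resolution_right resE) mE.
have ha : h a = 0.
  by apply: complexI; rewrite -hE (resolution_left resE) linear0l.
have := stieltjes_sum_le h_le part (M := s + d').
rewrite hb ha subr0.
have tags i : (i < size u)%N -> h u`_i != h (a :: u)`_i -> v`_i <= s + d'.
  move=> iu hne.
  have [_ _ tag] := part; have [/andP[l1 l2] l3] := tag i iu.
  have : (a :: u)`_i < s.
    rewrite ltNge; apply/negP => su; move: hne; rewrite /h !min_r ?eqxx //.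
    by rewrite (le_trans su) // (le_trans l1).
  by lra.
move=> /(_ tags) le; rewrite ler_norml => /andP[le1 _].
have d'le : d' <= (alpha - s) / 3 by rewrite ge_min lexx orbT.
by nra.
Qed.

(** The same comparison for [y = x - E s x], whose distribution function is
    constant before [s]. *)
Lemma resolution_above s : alpha < s -> E s x = x.
Proof.
move=> s_gt; suff ms1 : 1 <= m s.
  apply/esym/eqP; rewrite -subr_eq0 -(dnorm_eq0 dot).
  rewrite dotBl !dotBr dot_proj minxx -adjE' subrr subr0 dotx mE.
  have -> : m s = 1 by apply/eqP; rewrite eq_le ms1 m_le1.
  by rewrite subrr.
rewrite leNgt; apply/negP => ms_lt1.
pose h u := m u - m (Num.min u s).
have hE u : dot (E u (x - E s x)) x = (h u)%:C%C.
  by rewrite linB // dotBl resolution_min rmorphB /= !mE.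
have hmax u : h u = m (Num.max u s) - m s.
  by rewrite /h; case: (leP u s) => _; rewrite ?subrr.
have h_le : {homo h : u v / u <= v}.
  move=> u v uv; rewrite !hmax lerB // m_le //.
  by rewrite ge_max !le_max uv lexx orbT.
have c_gt0 : 0 < (s - alpha) / 3 by rewrite divr_gt0 // subr_gt0.
have c'_gt0 : 0 < (s - alpha) / 3 * (1 - m s) by rewrite mulr_gt0 // subr_gt0.
have n2 : `|x - E s x| <= 2.
  by rewrite (le_trans (ler_normB _ _)) // norm_x lerD.
have [d d_gt0 dP] := sum_approx hE n2 c'_gt0.
pose d' := Num.min d ((s - alpha) / 3).
have d'_gt0 : 0 < d' by rewrite lt_min d_gt0.
have [u [v part]] := tagged_partition_exists (resolution_lt resE) d'_gt0.
have := dP _ _ (tagged_partition_le (_ : d' <= d) part).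
rewrite ge_min lexx => /(_ isT).
have hb : h b = 1 - m s.
  by apply: complexI; rewrite -hE (resolution_right resE) dotBl rmorphB /= -mE dotx.
have ha : h a = 0.
  by apply: complexI; rewrite -hE (resolution_left resE) linear0l.
have := stieltjes_sum_ge h_le part (M := s - d').
rewrite hb ha subr0.
have tags i : (i < size u)%N -> h u`_i != h (a :: u)`_i -> s - d' <= v`_i.
  move=> iu hne.
  have [_ _ tag] := part; have [/andP[l1 l2] l3] := tag i iu.
  have : s < u`_i.
    rewrite ltNge; apply/negP => su; move: hne; rewrite !hmax !max_r ?eqxx //.
    by rewrite (le_trans _ su) // (le_trans l1).
  by lra.
move=> /(_ tags) le; rewrite ler_norml => /andP[_ le1].
have d'le : d' <= (s - alpha) / 3 by rewrite ge_min lexx orbT.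
by nra.
Qed.

(** The point [s = alpha] is reached from above by right continuity. *)
Lemma resolution_eigen s : E s x = if alpha <= s then x else 0.
Proof.
case: ltgtP => [s_gt|s_lt|<-]; [exact: resolution_above|exact: resolution_below|].
have right_lim : E t x @[t --> alpha^'+] --> x.
  apply: cvg_near_cst; near=> t.
  by apply: resolution_above; near: t; exact: nbhs_right_gt.
apply: (cvg_unique (@norm_hausdorff _ H) _ right_lim).
exact: (@resolution_right_cont _ _ _ _ _ _ _ resE alpha x).
Unshelve. all: by end_near. Qed.

End Eigen.
End Resolution.

(** * The Aluthge transform of a diagonalized polar decomposition *)

Section Atom.
Variable R : realType.

(** The mass that the Dirac mass at [c] gives to the [i]-th interval, which is
    open on the left and closed on the right. *)
Definition atom_weight (c a : R) (s : seq R) (i : nat) : R :=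
  (c <= s`_i)%R%:R - (c <= (a :: s)`_i)%R%:R.

(** The weights are nonnegative with sum [1], and a nonzero one forces its tag to
    be within [d] of [c]. *)
Lemma atom_average c a b d s t (f : nat -> R) F eps : a < c <= b ->
  tagged_partition a b d s t ->
  (forall i, (i < size s)%N -> `|t`_i - c| < d -> `|f i - F| <= eps) ->
  `|\sum_(i < size s) f i * atom_weight c a s i - F| <= eps.
Proof.
move=> /andP[ac cb] [ps _ tag] fF.
have w1 : \sum_(i < size s) atom_weight c a s i = 1.
  rewrite (telescope_partition (fun u => (c <= u)%R%:R) ps).
  by rewrite cb leNgt ac subr0.
have -> : \sum_(i < size s) f i * atom_weight c a s i - F =
    \sum_(i < size s) (f i - F) * atom_weight c a s i.
  under [RHS]eq_bigr do rewrite mulrBl.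
  by rewrite sumrB -mulr_sumr w1 mulr1.
rewrite (le_trans (ler_norm_sum _ _ _)) // -[leRHS]mulr1 -w1 mulr_sumr.
apply: ler_sum => i _; have [/andP[l1 l2] l3] := tag i (ltn_ord i).
rewrite /atom_weight; have [cs|sc] := leP c s`_i; last first.
  have -> : (c <= (a :: s)`_i) = false.
    by rewrite leNgt (le_lt_trans (le_trans l1 l2) sc).
  by rewrite subrr !mulr0 normr0.
have [cs'|sc'] := leP c (a :: s)`_i; first by rewrite subrr !mulr0 normr0.
by rewrite subr0 !mulr1; apply: fF => //; rewrite ltr_norml; apply/andP; split; lra.
Qed.

Lemma positive_bounds n (g : 'I_n -> R) : (forall p, 0 < g p) ->
  exists a b, [/\ 0 < a, a < b & forall p, a < g p <= b].
Proof.
move=> g_gt0; pose G := 1 + \sum_p (g p)^-1.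
have S_ge0 : 0 <= \sum_p (g p)^-1 by apply: sumr_ge0 => p _; rewrite invr_ge0 ltW.
have S2_ge0 : 0 <= \sum_p g p by apply: sumr_ge0 => p _; rewrite ltW.
have G_ge1 : 1 <= G by rewrite lerDl.
have G_gt0 : 0 < G by exact: lt_le_trans G_ge1.
(* [1 / a] exceeds every [1 / g p]; the constants [1] and [2] keep [a < b] when
   [n = 0] *)
exists G^-1, (2 + \sum_p g p); split=> [||p]; first by rewrite invr_gt0.
  by rewrite (@le_lt_trans _ _ 1) ?invf_le1 //; lra.
apply/andP; split.
  rewrite -[g p]invrK ltf_pV2 ?posrE ?invr_gt0 // /G (bigD1 p) //= addrCA ltrDl.
  by rewrite ltr_wpDr // sumr_ge0 // => q _; rewrite invr_ge0 ltW.
rewrite (bigD1 p) //= addrCA lerDl addr_ge0 // sumr_ge0 // => q _.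
by rewrite ltW.
Qed.

Lemma uniform_modulus n (g : 'I_n -> R) (phi : R -> R -> R) :
  (forall p q, {for (g p, g q), continuous (fun z => phi z.1 z.2)}) ->
  forall eps, 0 < eps -> exists2 d, 0 < d & forall p q s t,
    `|s - g p| < d -> `|t - g q| < d -> `|phi s t - phi (g p) (g q)| <= eps.
Proof.
move=> phi_cont eps eps_gt0.
have near_pq (pq : 'I_n * 'I_n) : exists d : R, 0 < d /\ forall s t,
    `|s - g pq.1| < d -> `|t - g pq.2| < d ->
    `|phi s t - phi (g pq.1) (g pq.2)| <= eps.
  have /cvgrPdist_le/(_ _ eps_gt0)/nbhs_ballP[d /= d_gt0 dP] := phi_cont pq.1 pq.2.
  exists d; split=> // s t ds dt; rewrite distrC; apply: (dP (s, t)).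
  by split; rewrite /= /ball /= distrC.
have [d dP] := choice near_pq.
exists (\big[Num.min/1]_pq d pq).
  by apply: lt_bigmin => // pq _; have [] := dP pq.
move=> p q s t sp tq; have [_] := dP (p, q); apply.
  by apply: lt_le_trans sp _; exact: (bigmin_le_cond _ (j := (p, q))).
by apply: lt_le_trans tq _; exact: (bigmin_le_cond _ (j := (p, q))).
Qed.

End Atom.

Section Aluthge.
Variables (R : realType) (H : completeNormedModType R[i]).
Variable dot : {dot H for Num.conj}.
Hypothesis hilbertH : hilbert_dot dot.
Variables (n : nat) (e : 'I_n -> H).
Hypothesis onb : orthobasis dot e.
Variable g : 'I_n -> R.

Definition diag_resolution (s : R) : H -> H :=
  diag_op dot e (fun p => (g p <= s)%R%:R).

Lemma diag_resolution_lin s : linear (diag_resolution s).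
Proof. exact: diag_op_lin. Qed.

Lemma diag_resolution_e s p : diag_resolution s (e p) = if g p <= s then e p else 0.
Proof.
rewrite /diag_resolution diag_op_e //; case: (g p <= s).
  by rewrite rmorph1 scale1r.
by rewrite rmorph0 scale0r.
Qed.

Lemma resolution_diagE a b E : spectral_resolution dot (diag_op dot e g) a b E ->
  E = diag_resolution.
Proof.
move=> resE; apply/funext => s.
have [[linE _] _ _] := resolution_proj resE s.
apply: (lin_ext onb linE (diag_resolution_lin s)) => p.
rewrite diag_resolution_e.
exact: (resolution_eigen hilbertH onb resE (norm_e onb hilbertH p) (diag_op_e onb g p)).
Qed.

(** The conditions [E a = 0] and [E b = id] confine the eigenvalues to [a < . <= b]. *)
Lemma resolution_bounds a b :
  spectral_resolution dot (diag_op dot e g) a b diag_resolution ->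
  forall p, a < g p <= b.
Proof.
move=> res p; have ep0 : e p != 0 by rewrite -normr_gt0 (norm_e onb hilbertH).
apply/andP; split.
  have := congr1 (@^~ (e p)) (resolution_left res).
  rewrite /= diag_resolution_e; case: leP => // _ /eqP.
  by rewrite (negPf ep0).
have := congr1 (@^~ (e p)) (resolution_right res).
rewrite /= diag_resolution_e; case: leP => // _ /esym/eqP.
by rewrite (negPf ep0).
Qed.

Lemma increment_coord a s i x p :
  dot (increment diag_resolution a s i x) (e p) =
  (atom_weight (g p) a s i)%:C%C * dot x (e p).
Proof.
by rewrite /increment dotBl !diag_op_coord // rmorphB mulrBl.
Qed.

Lemma increment_e a s i p :
  increment diag_resolution a s i (e p) = (atom_weight (g p) a s i)%:C%C *: e p.
Proof.
apply: (onb_ext onb) => q; rewrite increment_coord dotZl onb.1.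
by case: eqVneq => [->|] //=; rewrite !mulr0.
Qed.

Lemma increment_lin a s i : linear (increment diag_resolution a s i).
Proof.
move=> c x y; rewrite /increment !diag_resolution_lin scalerBr.
by rewrite opprD addrACA.
Qed.

(** In the eigenbasis both increments are multiplications by the weights of Dirac
    masses, so that the entry of the double sum is [u p q] times an average of
    [phi] near [(g p, g q)]. *)
Lemma double_sum_entry (phi : R -> R -> R) (U : H -> H) a b d s t s' t' p q eps :
  linear U -> tagged_partition a b d s t -> tagged_partition a b d s' t' ->
  a < g p <= b -> a < g q <= b ->
  (forall u v, `|u - g p| < d -> `|v - g q| < d -> `|phi u v - phi (g p) (g q)| <= eps) ->
  `|dot (\sum_(i < size s) \sum_(j < size s') (phi t`_i t'`_j)%:C%C *:
      increment diag_resolution a s i (U (increment diag_resolution a s' j (e q)))) (e p) -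
    (phi (g p) (g q))%:C%C * dot (U (e q)) (e p)| <= eps%:C%C * `|dot (U (e q)) (e p)|.
Proof.
move=> lU part part' gp gq phiP.
have -> : dot (\sum_(i < size s) \sum_(j < size s') (phi t`_i t'`_j)%:C%C *:
      increment diag_resolution a s i (U (increment diag_resolution a s' j (e q)))) (e p) =
   (\sum_(i < size s) (\sum_(j < size s') phi t`_i t'`_j * atom_weight (g q) a s' j)
      * atom_weight (g p) a s i)%:C%C * dot (U (e q)) (e p).
  rewrite dot_suml rmorph_sum mulr_suml; apply: eq_bigr => i _.
  rewrite dot_suml mulr_suml rmorph_sum mulr_suml; apply: eq_bigr => j _.
  rewrite dotZl increment_coord increment_e linZ // dotZl !rmorphM !mulrA /=.
  by congr (_ * _); rewrite mulrAC.
rewrite -mulrBl normrM ler_wpM2r // -rmorphB /= normcR lecR.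
apply: (atom_average (f := fun i => \sum_(j < size s')
  phi t`_i t'`_j * atom_weight (g q) a s' j) gp part) => i _ ti.
apply: (atom_average (f := fun j => phi t`_i t'`_j) gq part') => j _ tj.
exact: phiP.
Qed.

Lemma diag_resolutionP a b : a < b -> (forall p, a < g p <= b) ->
  spectral_resolution dot (diag_op dot e g) a b diag_resolution.
Proof.
move=> ab gab; split=> //.
- move=> s; split; first exact: (lin_bounded_op onb hilbertH (diag_resolution_lin s)).
    rewrite /diag_resolution (diag_op_comp onb); congr (diag_op _ _ _).
    by apply/funext => p; case: (_ <= _); rewrite ?mulr1 ?mulr0.
  by rewrite /diag_resolution (adj_diag onb hilbertH).
- move=> s t st; rewrite /diag_resolution (diag_op_comp onb); congr (diag_op _ _ _).
  apply/funext => p; have [gs|] := leP (g p) s; last by rewrite mul0r.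
  by rewrite (le_trans gs st) mulr1.
- move=> s x; apply: cvg_near_cst.
  have : \forall t \near s^'+, forall p, (g p <= t) = (g p <= s).
    apply: filter_forall => p; have [gs|sg] := leP (g p) s.
      near=> t; apply/ltW; apply: (le_lt_trans gs); near: t; exact: nbhs_right_gt.
    near=> t; apply/negbTE; rewrite -ltNge; near: t; exact: nbhs_right_lt.
  apply: filterS => t gt; rewrite /diag_resolution; congr (diag_op _ _ _ _).
  by apply/funext => p; rewrite gt.
- apply/funext => x; apply: (onb_ext onb) => p; rewrite diag_op_coord // linear0l.
  by have /andP[ag _] := gab p; rewrite leNgt ag mul0r.
- apply/funext => x; apply: (onb_ext onb) => p; rewrite diag_op_coord //.
  by have /andP[_ gb] := gab p; rewrite gb mul1r.
move=> eps eps_gt0; have [_ r_gt0] := gt0_complex eps_gt0.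
have M_gt0 : 0 < (n * n)%:R + 1 :> R by rewrite ltr_wpDl.
exists (complex.Re eps / ((n * n)%:R + 1)); first by rewrite divr_gt0.
move=> s t part.
set D := fun x : H =>
  \sum_(i < size s) (t`_i)%:C%C *: increment diag_resolution a s i x - diag_op dot e g x.
have linD : linear D.
  move=> c x y; rewrite /D (diag_op_lin _ _ _ c) scalerBr opprD [RHS]addrACA; congr (_ + _).
  rewrite scaler_sumr -big_split /=; apply: eq_bigr => i _.
  by rewrite (increment_lin _ _ _ c) scalerDr !scalerA [c * _]mulrC.
have ent p q : `|dot (D (e q)) (e p)| <=
    (complex.Re eps / ((n * n)%:R + 1))%:C%C.
  rewrite /D dotBl diag_op_coord // dot_suml.
  under eq_bigr do rewrite dotZl increment_coord mulrA -rmorphM.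
  rewrite -mulr_suml -rmorph_sum -mulrBl -rmorphB /= normrM normcR onb.1.
  rewrite -[leRHS]mulr1; apply: ler_pM => //; first by rewrite ler0c.
    rewrite lecR; apply: (atom_average (f := fun i => t`_i) (gab p) part).
    by move=> i _ /ltW.
  by case: eqP => _; rewrite ?normr1 ?normr0.
exact: (small_entries onb hilbertH eps_gt0 linD ent).
Unshelve. all: by end_near. Qed.

Variables (f : R -> R) (U S : H -> H).
Hypothesis g_gt0 : forall p, 0 < g p.
Hypothesis uU : unitary_op dot U.
Let phi s t := s * f (t / s).
Hypothesis f_cont : forall p q, {for (g p, g q), continuous (fun z => phi z.1 z.2)}.
Hypothesis linS : linear S.
Hypothesis S_entry : forall p q,
  dot (S (e q)) (e p) = (phi (g p) (g q))%:C%C * dot (U (e q)) (e p).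

Let linU : linear U. Proof. by case: uU. Qed.

Let U_entry p q : `|dot (U (e q)) (e p)| <= 1.
Proof.
rewrite (le_trans (norm_dot_le hilbertH _ _)) // (norm_e onb) // mulr1.
rewrite -(@ler_pXn2r _ 2) ?nnegrE // expr1n hilbertH (unitary_dot hilbertH onb) //.
by rewrite onb.1 eqxx.
Qed.

(** The entries of the double sums have the limits prescribed by [S]: this gives
    both that [S] is a double operator integral, for the resolution
    [diag_resolution], and that any other candidate [S'] has the entries of [S]. *)
Lemma aluthge_diag : aluthge dot f (U \o diag_op dot e g) = S.
Proof.
set T := U \o _.
have [absT phaseT] := polar_diag hilbertH onb g_gt0 uU.
have alS : is_aluthge dot f T S.
  split; first exact: (lin_bounded_op onb hilbertH linS).
  have [a [b [a_gt0 ab gab]]] := positive_bounds g_gt0.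
  exists a, b, diag_resolution; rewrite absT phaseT; split=> //.
    exact: diag_resolutionP.
  move=> eps eps_gt0; have [_ r_gt0] := gt0_complex eps_gt0.
  have M_gt0 : 0 < (n * n)%:R + 1 :> R by rewrite ltr_wpDl.
  have [|d d_gt0 dP] := uniform_modulus f_cont
    (eps := complex.Re eps / ((n * n)%:R + 1)).
    by rewrite divr_gt0.
  exists d => // s t s' t' part part'.
  set D := fun x : H => \sum_(i < size s) \sum_(j < size s') (phi t`_i t'`_j)%:C%C *:
    increment diag_resolution a s i (U (increment diag_resolution a s' j x)) - S x.
  have linD : linear D.
    move=> c x y; rewrite /D linS scalerBr opprD [RHS]addrACA; congr (_ + _).
    rewrite scaler_sumr -big_split /=; apply: eq_bigr => i _.
    rewrite scaler_sumr -big_split /=; apply: eq_bigr => j _.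
    rewrite (increment_lin _ _ _ c) linU (increment_lin _ _ _ c) scalerDr !scalerA.
    by rewrite [c * _]mulrC.
  have ent p q : `|dot (D (e q)) (e p)| <=
    (complex.Re eps / ((n * n)%:R + 1))%:C%C.
    rewrite /D dotBl S_entry.
    have := double_sum_entry linU part part' (gab p) (gab q) (dP p q).
    move=> /le_trans; apply.
    rewrite -[leRHS]mulr1 ler_wpM2l //.
    by rewrite ler0c divr_ge0 // ltW.
  exact: (small_entries onb hilbertH eps_gt0 linD ent).
have [bS' [a [b [E [a_gt0 res doi]]]]] := getPex (ex_intro _ S alS).
rewrite -/(aluthge dot f T) in bS' doi *.
have linS' := bS'.1; move: res doi; rewrite absT phaseT => res.
have EE := resolution_diagE res; rewrite EE in res * => doi.
have gab := resolution_bounds res.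
apply: (lin_ext onb linS' linS) => q; apply: (onb_ext onb) => p.
rewrite S_entry; apply/eqP; rewrite -subr_eq0 -normr_le0.
set z := _ - _; have : forall r : R, 0 < r -> `|z| <= (r + r)%:C%C.
  move=> r r_gt0; have rc_gt0 : 0 < r%:C%C by rewrite ltcR.
  have [d1 d1_gt0 d1P] := doi _ rc_gt0.
  have [d2 d2_gt0 d2P] := uniform_modulus f_cont r_gt0.
  have d_gt0 : 0 < Num.min d1 d2 by rewrite lt_min d1_gt0.
  have [s [t part]] := tagged_partition_exists (resolution_lt res) d_gt0.
  have part1 : tagged_partition a b d1 s t.
    by apply: tagged_partition_le part; rewrite ge_min lexx.
  have part2 : tagged_partition a b d2 s t.
    by apply: tagged_partition_le part; rewrite ge_min lexx orbT.
  have l1 := d1P _ _ _ _ part1 part1 (e q).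
  have l2 := double_sum_entry linU part2 part2 (gab p) (gab q) (d2P p q).
  rewrite (norm_e onb hilbertH) mulr1 in l1.
  have := le_trans (norm_dot_le hilbertH _ (e p)) (ler_wpM2r (normr_ge0 (e p)) l1).
  rewrite (norm_e onb hilbertH) !mulr1 dotBl => {}l1.
  have {}l2 := le_trans l2 (ler_wpM2l (ltW rc_gt0) (U_entry p q)).
  rewrite mulr1 in l2.
  rewrite rmorphD /= /z; apply: le_trans (ler_distD _ _ _) (lerD _ l2).
  by rewrite distrC.
move=> small; have zE : `|z| = (complex.Re `|z|)%:C%C by rewrite RRe_real // normr_real.
rewrite zE lecR leNgt; apply/negP => r_gt0.
have r3 : 0 < complex.Re `|z| / 3 by rewrite divr_gt0.
by have := small _ r3; rewrite zE lecR; lra.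
Qed.

End Aluthge.

(** * Finite dimension *)

Section FiniteDimension.
Variables (R : realType) (H : completeNormedModType R[i]).
Variable dot : {dot H for Num.conj}.

Lemma Cn_orthobasis n : is_Cn dot n -> exists e : 'I_n -> H, orthobasis dot e.
Proof.
case=> J [[K JK KJ] dotE].
pose e i := K (delta_mx i 0).
have Je i j : J (e i) j 0 = (j == i)%:R by rewrite /e KJ mxE eqxx andbT.
have dot_e x i : dot x (e i) = J x i 0.
  rewrite dotE (bigD1 i) //= Je eqxx conjC1 mulr1 big1 ?addr0 // => j /negPf ji.
  by rewrite Je ji conjC0 mulr0.
exists e; split=> [i j|x]; first by rewrite dot_e Je eq_sym.
apply: (can_inj JK); rewrite linear_sum; apply/matrixP => j k; rewrite ord1 summxE.
rewrite (bigD1 j) //= linearZ mxE Je eqxx mulr1 dot_e big1 ?addr0 // => i /negPf ij.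
by rewrite linearZ mxE Je eq_sym ij mulr0.
Qed.

Hypothesis hilbertH : hilbert_dot dot.

Definition orthonormal_family k (e : 'I_k -> H) : Prop :=
  forall i j, dot (e i) (e j) = (i == j)%:R.

(** The images by [T] of orthonormal vectors lie in a compact set and are at
    distance at least [1 / C] of each other, where [C] bounds [T^-1]: a cover by
    balls of radius [1 / (2 C)] separates them. *)
Lemma compact_bounds_orthonormal (T : H -> H) :
  bounded_op T -> invertible_op T -> compact_op T ->
  exists N, forall k (e : 'I_k -> H), orthonormal_family e -> (k <= N)%N.
Proof.
move=> [lT _] [S [[lS cS] ST _]] cT.
have [C C_gt0 SC] := continuous_lin_bound lS cS.
pose eps := (2 * C)^-1; have eps_gt0 : 0 < eps by rewrite invr_gt0 mulr_gt0.
move: cT; rewrite /compact_op; set K := closure _; rewrite compact_cover => cT.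
have [||D _ Dcover] := cT H K (fun x => interior (ball x eps)).
- by move=> x Kx; exact: open_interior.
- by move=> x Kx; exists x => //; exact: nbhsx_ballx.
exists (size (finmap.enum_fset D)) => k e oe.
have Te i : exists c, c \in finmap.enum_fset D /\ `|c - T (e i)| < eps.
  have : K (T (e i)).
    apply: subset_closure; exists (e i) => //=.
    by rewrite -(@ler_pXn2r _ 2) ?nnegrE // hilbertH oe eqxx expr1n.
  move=> /Dcover[c /= cD /interior_subset cT']; exists c; split=> //.
  by move: cT'; rewrite -ball_normE.
have [h hP] := choice Te.
have h_inj : injective h.
  move=> i j hij; apply/eqP; apply: contraT => ij.
  have lt1 : `|T (e i) - T (e j)| < C^-1.
    have -> : C^-1 = eps + eps.
      by rewrite /eps invfM -mulrDl -[X in X + _]mul1r -[X in _ + X]mul1r -splitr mul1r.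
    apply: le_lt_trans (ler_distD (h i) _ _) _.
    by apply: ltrD; [rewrite distrC; exact: (hP i).2 | rewrite hij; exact: (hP j).2].
  have lt2 : `|e i - e j| < 1.
    have /(congr1 (@^~ (e i - e j))) /= <- := ST.
    apply: le_lt_trans (SC _) _.
    by rewrite linB // -(mulfV (lt0r_neq0 C_gt0)) ltr_pM2l.
  have : `|e i - e j| ^+ 2 = 2.
    rewrite hilbertH dotBl !dotBr !oe !eqxx (negPf ij) eq_sym (negPf ij).
    by rewrite subr0 sub0r opprK.
  move=> /eqP; rewrite lt_eqF // (@lt_trans _ _ 1) ?ltr1n //.
  by rewrite exprn_ilt1.
have := @uniq_leq_size _ [seq h i | i <- enum 'I_k] (finmap.enum_fset D).
rewrite size_map size_enum_ord map_inj_uniq ?enum_uniq //; apply=> // _ /mapP[i _ ->].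
exact: (hP i).1.
Qed.

(** An orthonormal family of maximal size is a basis: the component of a vector
    orthogonal to it could otherwise be normalized and added to it. *)
Lemma max_orthonormal_orthobasis N :
  (forall k (e : 'I_k -> H), orthonormal_family e -> (k <= N)%N) ->
  exists n (e : 'I_n -> H), orthobasis dot e.
Proof.
move=> bound.
pose P k := `[< exists e : 'I_k -> H, orthonormal_family e >].
have exP : exists k, P k.
  by exists 0%N; apply/asboolP; exists (fun=> 0) => -[].
have leP k : P k -> (k <= N)%N by move=> /asboolP[e /bound].
case: (ex_maxnP exP leP) => n /asboolP[e oe] nmax.
exists n, e; split=> // x; apply/eqP; rewrite -subr_eq0; apply: contraT => y0.
set y := x - _ in y0.
have ye i : dot y (e i) = 0.
  rewrite /y dotBl dot_suml (bigD1 i) //= dotZl oe eqxx mulr1 big1 ?addr0 ?subrr //.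
  by move=> j /negPf ji; rewrite dotZl oe ji mulr0.
pose z := `|y|^-1 *: y.
have z_e i : dot z (e i) = 0 by rewrite dotZl ye mulr0.
have e_z i : dot (e i) z = 0 by rewrite dotC z_e conjC0.
have zz : dot z z = 1.
  rewrite -hilbertH normrZ ger0_norm ?invr_ge0 // mulVf ?expr1n //.
  by rewrite normr_eq0.
have := nmax n.+1; rewrite ltnn; apply.
apply/asboolP; exists (fun i => oapp e z (unlift ord0 i)) => i j.
case: unliftP => [i'|] ->; case: unliftP => [j'|] -> /=.
- by rewrite oe (inj_eq lift_inj).
- by rewrite e_z.
- by rewrite z_e.
- by rewrite zz.
Qed.

Lemma finite_orthobasis (T : H -> H) : bounded_op T -> invertible_op T ->
  compact_op T \/ (exists n, is_Cn dot n) ->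
  exists n (e : 'I_n -> H), orthobasis dot e.
Proof.
move=> bT iT [cT|[n /Cn_orthobasis[e onb]]]; last by exists n, e.
by have [N] := compact_bounds_orthonormal bT iT cT; exact: max_orthonormal_orthobasis.
Qed.

End FiniteDimension.

(** * Power means *)

Section PowerMean.
Variable R : realType.
Implicit Types r lam s t x : R.

Lemma powR_continuous r x : 0 < x -> {for x, continuous (fun a : R => a `^ r)}.
Proof.
move=> x_gt0; apply: differentiable_continuous; apply/derivable1_diffP.
by apply: derivable_powR; rewrite in_itv /= andbT.
Qed.

Section Fixed.
Variables r lam : R.
Hypothesis r_neq0 : r != 0.
Hypothesis lam01 : 0 < lam < 1.

Lemma convex_gt0 s t : 0 < s -> 0 < t -> 0 < (1 - lam) * s + lam * t.
Proof.
by have /andP[l0 l1] := lam01; move=> s0 t0; rewrite addr_gt0 // mulr_gt0 ?subr_gt0.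
Qed.

Lemma power_mean_gt0 x : 0 < x -> 0 < power_mean r lam x.
Proof.
move=> x_gt0; rewrite powR_gt0 // -[1 - lam]mulr1.
by rewrite convex_gt0 // powR_gt0.
Qed.

(** In the variables [s ^ r] and [t ^ r], the mean is a weighted arithmetic mean. *)
Lemma power_mean_powR s t : 0 < s -> 0 < t ->
  (s * power_mean r lam (t / s)) `^ r = lam * t `^ r + (1 - lam) * s `^ r.
Proof.
move=> s_gt0 t_gt0; have ts_gt0 : 0 < t / s by rewrite divr_gt0.
rewrite powRM ?ltW ?power_mean_gt0 // -powRrM mulVf // powRr1; last first.
  by rewrite -[1 - lam]mulr1 ltW // convex_gt0 // powR_gt0.
rewrite mulrDr addrC mulrCA -powRM ?ltW // [s * _]mulrC divfK ?gt_eqF //.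
by rewrite [s `^ r * _]mulrC.
Qed.

Lemma power_mean_continuous s t : 0 < s -> 0 < t ->
  {for (s, t), continuous (fun z : R * R => z.1 * power_mean r lam (z.2 / z.1))}.
Proof.
move=> s_gt0 t_gt0; have ts_gt0 : 0 < t / s by rewrite divr_gt0.
rewrite /prop_for /continuous_at /=.
have c1 : z.1 @[z --> (s, t)] --> s by exact: cvg_fst.
have c2 : z.2 @[z --> (s, t)] --> t by exact: cvg_snd.
apply: cvgM => //.
apply: (@continuous_cvg _ _ _ _ _ (fun z : R * R => 1 - lam + lam * (z.2 / z.1) `^ r)
  (fun a => a `^ r^-1)).
  by apply: powR_continuous; rewrite -[1 - lam]mulr1 convex_gt0 // powR_gt0.
apply: cvgD; first exact: cvg_cst.
apply: cvgMr; apply: (@continuous_cvg _ _ _ _ _ (fun z : R * R => z.2 / z.1)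
  (fun a => a `^ r)); first exact: powR_continuous.
by apply: cvgM => //; apply: cvgV => //; rewrite gt_eqF.
Qed.

End Fixed.

Lemma real_scale_cvg (H : completeNormedModType R[i]) (u : nat -> R) (l : R) (v : H) :
  u m @[m --> \oo] --> l -> (u m)%:C%C *: v @[m --> \oo] --> l%:C%C *: v.
Proof.
move=> ul; apply/cvgrPdist_lt => eps eps_gt0.
have [epsE r_gt0] := gt0_complex eps_gt0.
have vE : `|v| = (complex.Re `|v|)%:C%C by rewrite RRe_real // normr_real.
have v_ge0 : 0 <= complex.Re `|v| by rewrite -ler0c -vE.
have v1_gt0 : 0 < complex.Re `|v| + 1 by rewrite ltr_wpDl.
have d_gt0 : 0 < complex.Re eps / (complex.Re `|v| + 1) by rewrite divr_gt0.
have /cvgrPdist_lt/(_ _ d_gt0) := ul.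
apply: filterS => m; rewrite ltr_pdivlMr // => lt.
rewrite -scalerBl normrZ -rmorphB /= normcR vE epsE -rmorphM /= ltcR.
by apply: le_lt_trans lt; rewrite ler_wpM2l // lerDl.
Qed.

End PowerMean.

(** * Iteration of the Aluthge transform *)

Section Iteration.
Variables (R : realType) (H : completeNormedModType R[i]).
Variable dot : {dot H for Num.conj}.
Hypothesis hilbertH : hilbert_dot dot.
Variables (n : nat) (e : 'I_n -> H).
Hypothesis onb : orthobasis dot e.
Variable U : H -> H.
Hypothesis uU : unitary_op dot U.

Let linU : linear U. Proof. by case: uU. Qed.
Let u p q := dot (U (e q)) (e p).

(** Some term of the Leibniz expansion of the determinant is nonzero. *)
Lemma unitary_permutation : exists s : {perm 'I_n}, forall j, u (s j) j != 0.
Proof.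
pose M := entries dot e U.
have uM : M \is unitarymx.
  apply/unitarymxP/matrixP => i j; rewrite !mxE -onb.1 -(unitary_dot hilbertH onb _ _ uU).
  by rewrite [RHS](parseval onb); apply: eq_bigr => k _; rewrite !mxE.
have : \det M != 0 by rewrite -unitfE -unitmxE unitarymx_unit.
have [/existsP[s sP] _|] := boolP [exists s : 'S_n, \prod_i M i (s i) != 0].
  exists s => j; by have /prodf_neq0/(_ j isT) := sP; rewrite mxE.
move=> /existsPn none; rewrite /determinant big1 ?eqxx // => s _.
by have /negPn/eqP -> := none s; rewrite mulr0.
Qed.

Variable s : {perm 'I_n}.

(** What remains of being centered once [U] and [|T|] are written in the joint
    eigenbasis: [U^*k |T| U^k] has the eigenvalues [a \o s^k] there, and [U]
    intertwines it with the next one.  Unlike [u i j != 0 -> a i = a (s j)] alone,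
    the condition for all [k] is stable under [mean_step]. *)
Definition linked (a : 'I_n -> R) : Prop := forall k i j, u i j != 0 ->
  a ((s ^+ k)%g i) = a ((s ^+ k.+1)%g j).

Definition mean_step (f : R -> R) (a : 'I_n -> R) : 'I_n -> R :=
  fun j => a (s j) * f (a j / a (s j)).

Lemma mean_step_linked f a : linked a -> linked (mean_step f a).
Proof.
move=> la k i j uij; rewrite /mean_step.
have sS l i' : s ((s ^+ l)%g i') = (s ^+ l.+1)%g i' by rewrite expgSr permM.
by rewrite !sS (la k i j) // (la k.+1 i j).
Qed.

(** By [linked], the entry [u p q] vanishes unless [a p = a (s q)]. *)
Lemma aluthge_step f a :
  (forall x y : R, 0 < x -> 0 < y ->
    {for (x, y), continuous (fun z : R * R => z.1 * f (z.2 / z.1))}) ->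
  (forall j, 0 < a j) -> linked a ->
  aluthge dot f (U \o diag_op dot e a) = U \o diag_op dot e (mean_step f a).
Proof.
move=> f_cont a_gt0 la; apply: (aluthge_diag hilbertH onb a_gt0 uU).
- by move=> p q; exact: f_cont.
- by apply: lin_comp => //; exact: diag_op_lin.
move=> p q; rewrite /= diag_op_e // linZ // dotZl -/(u p q).
have [->|upq] := eqVneq (u p q) 0; first by rewrite !mulr0.
have := la 0%N p q upq; rewrite expg0 perm1 expg1 => ->.
by [].
Qed.

Variables (a : 'I_n -> R) (r lam : R).
Hypothesis a_gt0 : forall j, 0 < a j.
Hypothesis a_linked : linked a.
Hypothesis r_neq0 : r != 0.
Hypothesis lam01 : 0 < lam < 1.

Let A m := iter m (mean_step (power_mean r lam)) a.

Lemma iter_aluthge m : (forall j, 0 < A m j) /\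
  iter m (aluthge dot (power_mean r lam)) (U \o diag_op dot e a) =
  U \o diag_op dot e (A m).
Proof.
suff: [/\ forall j, 0 < A m j, linked (A m) &
  iter m (aluthge dot (power_mean r lam)) (U \o diag_op dot e a) =
  U \o diag_op dot e (A m)] by case.
elim: m => [//|m [Am_gt0 lAm IHm]].
split=> [j||].
- by rewrite mulr_gt0 // power_mean_gt0 // divr_gt0.
- exact: mean_step_linked.
rewrite iterS IHm aluthge_step // => x y x_gt0 y_gt0.
exact: power_mean_continuous.
Qed.

Lemma iter_mean_powR m j : A m j `^ r = iter m (lazy_step s lam) (fun i => a i `^ r) j.
Proof.
elim: m j => [//|m IHm] j.
have Am_gt0 := (iter_aluthge m).1.
by rewrite [LHS]power_mean_powR // !IHm.
Qed.

Lemma iter_mean_cvg j :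
  A m j @[m --> \oo] --> cycle_mean s (fun i => a i `^ r) j `^ r^-1.
Proof.
have -> : (fun m => A m j) =
    (fun m => iter m (lazy_step s lam) (fun i => a i `^ r) j `^ r^-1).
  apply/funext => m; have Am_gt0 := (iter_aluthge m).1.
  by rewrite -iter_mean_powR -powRrM mulfV // powRr1 // ltW.
apply: (@continuous_cvg _ _ _ _ _ _ (fun x => x `^ r^-1)); last exact: lazy_walk_cvg.
apply: powR_continuous; rewrite mulr_gt0 ?invr_gt0 ?ltr0n ?order_gt0 //.
case: #[s]%g (order_gt0 s) => // N _.
rewrite big_ord_recl ltr_wpDr ?powR_gt0 // sumr_ge0 // => k _.
exact: powR_ge0.
Qed.

Lemma iter_aluthge_cvg :
  sot_cvg (fun m => iter m (aluthge dot (power_mean r lam)) (U \o diag_op dot e a))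
    (U \o diag_op dot e (fun j => cycle_mean s (fun i => a i `^ r) j `^ r^-1)).
Proof.
move=> x; under eq_fun do rewrite (iter_aluthge _).2.
have [_ contU] := lin_bounded_op onb hilbertH linU.
apply: (continuous_cvg _ (contU _)).
rewrite /diag_op; apply: cvg_big => [|i _]; first exact: add_continuous.
rewrite -scalerA; under eq_fun do rewrite -scalerA.
by apply: real_scale_cvg; exact: iter_mean_cvg.
Qed.

End Iteration.

Section Centered.
Variables (R : realType) (H : completeNormedModType R[i]).
Variable dot : {dot H for Num.conj}.
Hypothesis hilbertH : hilbert_dot dot.
Variables (n : nat) (e0 : 'I_n -> H).
Hypothesis onb0 : orthobasis dot e0.
Variables (U : H -> H) (g : 'I_n -> R).
Hypothesis uU : unitary_op dot U.
Hypothesis g_gt0 : forall i, 0 < g i.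

(** A joint eigenbasis of the operators [F k = U^*k |T| U^k], which commute as [T] is
    centered.  From [U (F k.+1) = (F k) U] the eigenvalues [al] satisfy
    [al k i = al k.+1 j] whenever the entry of [U] at [(i, j)] is nonzero. *)
Lemma centered_joint_basis : centered dot (U \o diag_op dot e0 g) ->
  exists e : 'I_n -> H, orthobasis dot e /\ exists (s : {perm 'I_n}) (a : 'I_n -> R),
    [/\ forall j, 0 < a j, linked dot e U s a & diag_op dot e0 g = diag_op dot e a].
Proof.
set A := diag_op dot e0 g; move=> cT.
have [linU UU1 UU2] := uU.
have lA : linear A by exact: diag_op_lin.
have [absT phaseT] := polar_diag hilbertH onb0 g_gt0 uU.
have [lUa adjU] := adjP onb0 hilbertH linU.
pose F k := iter k (adj dot U) \o A \o iter k U.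
have linF k : linear (F k).
  by apply: lin_comp; [apply: lin_comp => //; exact: lin_iter | exact: lin_iter].
have adjI k x y : dot (iter k U x) y = dot x (iter k (adj dot U) y).
  by elim: k x => // k IHk x; rewrite iterSr IHk adjU.
have adjI' k x y : dot (iter k (adj dot U) x) y = dot x (iter k U y).
  by rewrite dotC -adjI -dotC.
have adjF k x y : dot (F k x) y = dot x (F k y).
  by rewrite /F /= adjI' (diag_op_adj onb0) adjI.
have FT k : centered_family dot (U \o A) (F k).
  rewrite /centered_family absT phaseT.
  case: k => [|k]; first by left; right.
  by left; left; exists k.+1.
have commF k l : F k \o F l = F l \o F k by exact: cT.
have [e [onb [al alP]]] := codiagonalization onb0 linF adjF commF.
have al_link k i j : dot (U (e j)) (e i) != 0 -> al k i = al k.+1 j.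
  move=> uij; apply: complexI; apply: (mulIf uij).
  rewrite -(diag_op_coord onb) -alP -dotZl -linZ // -(diag_op_e onb) -alP.
  have -> : F k.+1 (e j) = adj dot U (F k (U (e j))).
    by rewrite /F /= -[U (iter k U _)]iterS iterSr.
  by have /(congr1 (@^~ (F k (U (e j))))) /= -> := UU2.
have [s u_s] := unitary_permutation hilbertH onb uU.
have al_perm k j : al k j = al 0%N ((s ^+ k)%g j).
  elim: k j => [|k IHk] j; first by rewrite expg0 perm1.
  by rewrite -(al_link k (s j) j (u_s j)) IHk expgS permM.
exists e; split=> //; exists s, (al 0%N); split.
- move=> j; have Ae : A (e j) = (al 0%N j)%:C%C *: e j.
    by rewrite -(diag_op_e onb) -alP.
  have [_ /(_ (e j))] := diag_op_pos hilbertH onb0 (fun i => ltW (g_gt0 i)).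
  rewrite -/A Ae dotZl onb.1 eqxx mulr1 ler0c lt_def => ->; rewrite andbT.
  apply/eqP => al0; move: Ae; rewrite al0 scale0r => /(diag_op_inj onb0) ej0.
  have := onb.1 j j; rewrite ej0; last by move=> i; rewrite gt_eqF.
  by rewrite linear0l eqxx => /esym/eqP; rewrite oner_eq0.
- by move=> k i j uij; rewrite -!al_perm (al_link k i j).
- exact: (alP 0%N).
Qed.

End Centered.

Theorem theorem6p3 (R : realType) (H : completeNormedModType R[i])
    (dot : {dot H for Num.conj}) (hilbertH : hilbert_dot dot)
    (r : R) (r_bound : -1 <= r <= 1) (r_neq0 : r != 0)
    (T : H -> H) (T_bounded : bounded_op T) (T_inv : invertible_op T)
    (T_centered : centered dot T)
    (T_compact_or_matrix : compact_op T \/ exists n, is_Cn dot n) :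
  exists L : H -> H, bounded_op L /\
    forall lambda : R, 0 < lambda < 1 ->
      sot_cvg (fun n => iter n (aluthge dot (power_mean r lambda)) T) L.
Proof.
have [n [e1 onb1]] := finite_orthobasis hilbertH T_bounded T_inv T_compact_or_matrix.
have [e0 [U [g [onb0 uU g_gt0 TE]]]] := polar_exists hilbertH onb1 T_bounded T_inv.
rewrite TE in T_centered *.
have [e [onb [s [a [a_gt0 a_linked AE]]]]] :=
  centered_joint_basis hilbertH onb0 uU g_gt0 T_centered.
rewrite AE.
exists (U \o diag_op dot e (fun j => cycle_mean s (fun i => a i `^ r) j `^ r^-1)).
split; last by move=> lambda lam01; exact: iter_aluthge_cvg.
apply: (lin_bounded_op onb hilbertH); apply: lin_comp; last exact: diag_op_lin.
by case: uU.
Qed.
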